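(* Let $(\nu_n)_{n\ge1}$ be a sequence of probability measures on $\mathbb{Z}$ and let $a>0$, $0\le\rho<1$ be constants such that for all $n$: (1) $E(\nu_n)=\sum_k k\,\nu_n(k)=0$; (2) $m_1(\nu_n)=\sum_k|k|\nu_n(k)\le a$; (3) $\nu_n(\beta\mathbb{Z}+r)\le\rho$ for all integers $\beta\notin\{1,-1\}$ and all $r\in\mathbb{Z}$ (with $0\cdot\mathbb{Z}+r=\{r\}$); (4) $\phi(n)=\sum_{i=1}^n m_2(\nu_i)=O(n)$, where $m_2(\nu)=\sum_k k^2\nu(k)$. Let $\mu_n=\nu_1*\cdots*\nu_n$. Then for every $f\in L^1(X)$, $\mu_nf(x)=\sum_{k\in\mathbb{Z}}\mu_n(k)f(\tau^kx)$ converges for $m$-almost every $x\in X$.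
   Context: $(X,\mathcal{B},m)$ is a non-atomic separable probability space and $\tau:X\to X$ is an invertible measure-preserving transformation. Convolution: $(\mu*\nu)(k)=\sum_{j}\mu(k-j)\nu(j)$. *)

(* Defs.v *)
From HB Require Import structures.
From mathcomp Require Import all_boot all_order all_algebra.
From mathcomp Require Import all_classical all_reals all_analysis.
Set Implicit Arguments. Unset Strict Implicit. Unset Printing Implicit Defensive.
Import Order.TTheory GRing.Theory Num.Theory.
Import numFieldNormedType.Exports.
Local Open Scope classical_set_scope.
Local Open Scope ring_scope.

Section Defs.
Context {R : realType}.

(** Sum over Z of a real-valued function: (sum of positive parts) - (sum of negative parts).
    For absolutely summable u this is the usual sum. *)
Definition zsum (u : int -> R) : \bar R :=
  (\esum_(k in [set: int]) (Num.max (u k) 0)%:E - \esum_(k in [set: int]) (Num.max (- u k) 0)%:E)%E.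

Definition zmass (nu : int -> R) (S : set int) : \bar R :=
  \esum_(k in S) (nu k)%:E.

Definition zprob (nu : int -> R) : Prop :=
  (forall k, 0 <= nu k) /\ zmass nu [set: int] = 1%E.

Definition zmean (nu : int -> R) : \bar R := zsum (fun k => k%:~R * nu k).
Definition m1 (nu : int -> R) : \bar R := zmass (fun k => `|k%:~R| * nu k) [set: int].
Definition m2 (nu : int -> R) : \bar R := zmass (fun k => (k%:~R) ^+ 2 * nu k) [set: int].

Definition coset (beta r : int) : set int := [set k | exists j : int, k = beta * j + r].

Definition zconv (mu nu : int -> R) (k : int) : R := fine (zsum (fun j => mu (k - j) * nu j)).

Definition dirac0 (k : int) : R := if k == 0 then 1 else 0.

Fixpoint convpow (nu : nat -> int -> R) (n : nat) : int -> R :=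
  match n with
  | 0%N => dirac0
  | n'.+1 => zconv (convpow nu n') (nu n'.+1)
  end.

Definition ziter {T : Type} (tau tauinv : T -> T) (k : int) (x : T) : T :=
  match k with
  | Posz n => iter n tau x
  | Negz n => iter n.+1 tauinv x
  end.

Context {d : measure_display} {X : measurableType d}.

Definition nonatomic (m : set X -> \bar R) : Prop :=
  forall A, measurable A -> (0 < m A)%E ->
    exists B, [/\ measurable B, B `<=` A, (0 < m B)%E & (m B < m A)%E].

Definition separable_measure (m : set X -> \bar R) : Prop :=
  exists G : nat -> set X, (forall n, measurable (G n)) /\
    forall A, measurable A -> forall e : R, 0 < e ->
      exists n, (m ((A `\` G n) `|` (G n `\` A)) < e%:E)%E.

Definition inv_mpt (m : set X -> \bar R) (tau tauinv : X -> X) : Prop :=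
  [/\ measurable_fun setT tau, measurable_fun setT tauinv,
      cancel tau tauinv, cancel tauinv tau &
      forall A, measurable A -> m (tau @^-1` A) = m A].

End Defs.

(* Main.v *)
Require Import Defs.
From HB Require Import structures.
From mathcomp Require Import all_boot all_order all_algebra.
From mathcomp Require Import all_classical all_reals all_analysis.
From mathcomp Require Import measurable_realfun zify ring lra.
Import Order.TTheory GRing.Theory Num.Theory.
Import numFieldNormedType.Exports.
Local Open Scope classical_set_scope.
Local Open Scope ring_scope.
Set Implicit Arguments. Unset Strict Implicit. Unset Printing Implicit Defensive.

(* Write [D mu (k) = mu (k - 1) - mu k].  Two kernel estimates suffice:
   [sum_k |D mu_n (k)| <= C / sqrt n] and [sum_k |k| |D mu_n (k)| <= B].
   For the first, tightness (from the bound on m1) and the aperiodicity hypothesis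
   give [M] and [dl > 0] such that the atoms of [nu_i] in [-M, M] of mass at least
   [dl] have differences of gcd 1.  If [nu_i] has two such atoms at distance [d] for
   a positive proportion of the [i], each of them contributes a coin flip of step
   [d], whence a bound of order [1 / sqrt n] for the [d]-difference of [mu_n]; by
   pigeonhole this applies to a set of [d] with gcd 1, and Bezout gives [d = 1].
   For the second, write [mu_n] as the convolution of its two halves, apply
   Leibniz' rule to multiplication by [k], and use [m2 (mu_n) = O (n)], which holds
   because the [nu_i] are centered.
   Summation by parts then reduces the claim to Birkhoff's theorem along the two
   half-orbits with a common limit.  The set where the forward (or backward)
   averages of [f] exceed [q] in the limit while the forward (or backward) ones fall
   below [p < q] is invariant, so two applications of the maximal ergodic theorem
   on it show that it is null. *)

(** * Absolutely summable families *)

Section Summation.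
Context {R : realType}.
Implicit Type T : choiceType.

Definition asum T (u : T -> R) : Prop := (\esum_(i in [set: T]) `|u i|%:E < +oo)%E.

(* At [T := int], [csum u] is convertible to [fine (zsum u)]. *)
Definition csum T (u : T -> R) : R :=
  fine (\esum_(i in [set: T]) (Num.max (u i) 0)%:E -
        \esum_(i in [set: T]) (Num.max (- u i) 0)%:E)%E.

Lemma asum_le T (u v : T -> R) : (forall i, `|u i| <= `|v i|) -> asum v -> asum u.
Proof.
move=> uv; apply: le_lt_trans; apply: le_esum => i _; by rewrite lee_fin.
Qed.

Lemma asum_abs T (u : T -> R) : asum u -> asum (fun i => `|u i|).
Proof. by apply: asum_le => i; rewrite normr_id. Qed.

(** One inequality is checked on finite partial sums and passes to the supremum; the other is the
    same inequality for [c^-1] and the scaled family. *)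
Lemma esumZl T (c : R) (u : T -> R) : 0 <= c -> (forall i, 0 <= u i) ->
  (\esum_(i in [set: T]) (c * u i)%:E = c%:E * \esum_(i in [set: T]) (u i)%:E)%E.
Proof.
rewrite le_eqVlt => /predU1P[<- u0|].
  by rewrite mul0e esum1// => i _; rewrite mul0r.
have key (b : R) (v : T -> R) : 0 < b -> (forall i, 0 <= v i) ->
    (\esum_(i in [set: T]) (b * v i)%:E <= b%:E * \esum_(i in [set: T]) (v i)%:E)%E.
  move=> b0 v0; apply: ge_ereal_sup => _ [X [fX _]] <-.
  rewrite [leLHS](_ : _ = (b%:E * (\sum_(x \in X) (v x)%:E))%E); last first.
    rewrite !fsbig_finite//= ge0_sume_distrr; last by move=> i _; rewrite lee_fin.
    by apply: eq_bigr => i _; rewrite EFinM.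
  apply: lee_pmul => //; [by rewrite lee_fin ltW| | ].
    by rewrite fsume_ge0// => i _; rewrite lee_fin.
  by apply: esum_ge; exists X.
move=> c0 u0; apply/eqP; rewrite eq_le key//=.
have ci : 0 < c^-1 by rewrite invr_gt0.
have := key c^-1 (fun i => c * u i) ci (fun i => mulr_ge0 (ltW c0) (u0 i)).
under eq_esum do rewrite mulKf ?gt_eqF//.
move=> h; have := @lee_pmul _ c%:E c%:E _ _ _ _ (lexx _) h.
rewrite muleA -EFinM divff ?gt_eqF// mul1e; apply.
  by rewrite lee_fin ltW.
by apply: esum_ge0 => i _; rewrite lee_fin.
Qed.

Lemma asumD T (u v : T -> R) : asum u -> asum v -> asum (fun i => u i + v i).
Proof.
move=> su sv; rewrite /asum.
apply: (@le_lt_trans _ _ (\esum_(i in [set: T]) (`|u i|%:E + `|v i|%:E))%E).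
  by apply: le_esum => i _; rewrite -EFinD lee_fin ler_normD.
rewrite esumD; [|by move=> *; rewrite lee_fin..].
by rewrite lte_add_pinfty.
Qed.

Lemma asumZ T c (u : T -> R) : asum u -> asum (fun i => c * u i).
Proof.
move=> su; rewrite /asum; under eq_esum do rewrite normrM.
rewrite esumZl//; move: su; rewrite /asum.
have : (0 <= \esum_(i in [set: T]) `|u i|%:E)%E.
  by apply: esum_ge0 => i _; rewrite lee_fin.
by case: esum => [r||]//= _ _; rewrite -EFinM ltry.
Qed.

Lemma asumN T (u : T -> R) : asum u -> asum (fun i => - u i).
Proof. by apply: asum_le => i; rewrite normrN. Qed.

Lemma asumB T (u v : T -> R) : asum u -> asum v -> asum (fun i => u i - v i).
Proof. by move=> su sv; apply: asumD => //; apply: asumN. Qed.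

Lemma max0_ge0 (x : R) : 0 <= Num.max x 0.
Proof. by rewrite le_max lexx orbT. Qed.

Lemma asum_pos T (u : T -> R) : asum u -> asum (fun i => Num.max (u i) 0).
Proof.
by apply: asum_le => i; case: (lerP 0 (u i)) => h; rewrite ?normr0 ?normr_ge0.
Qed.

Lemma esum_fin T (u : T -> R) : (forall i, 0 <= u i) -> asum u ->
  \esum_(i in [set: T]) (u i)%:E = (fine (\esum_(i in [set: T]) (u i)%:E))%:E.
Proof.
move=> u0; rewrite /asum; under eq_esum do rewrite ger0_norm//.
move=> h; rewrite fineK// ge0_fin_numE//.
by apply: esum_ge0 => i _; rewrite lee_fin.
Qed.

Lemma csum_def_fin T (u : T -> R) : asum u ->
  (\esum_(i in [set: T]) (Num.max (u i) 0)%:E -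
        \esum_(i in [set: T]) (Num.max (- u i) 0)%:E)%E = (csum u)%:E.
Proof.
move=> su; rewrite /csum esum_fin; last exact: asum_pos.
  rewrite [X in (_ - X)%E]esum_fin//.
    by move=> i; rewrite le_max lexx orbT.
  by apply: asum_pos; exact: asumN.
by move=> i; rewrite le_max lexx orbT.
Qed.

Lemma csum_ge0E T (u : T -> R) : (forall i, 0 <= u i) ->
  csum u = fine (\esum_(i in [set: T]) (u i)%:E).
Proof.
move=> u0; rewrite /csum [X in (_ - X)%E]esum1 ?sube0.
  by congr fine; apply: eq_esum => i _; rewrite max_l.
by move=> i _; rewrite max_r// oppr_le0.
Qed.

Lemma esum_csum T (u : T -> R) : (forall i, 0 <= u i) -> asum u ->
  \esum_(i in [set: T]) (u i)%:E = (csum u)%:E.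
Proof. by move=> u0 su; rewrite csum_ge0E// esum_fin. Qed.

Lemma ge0_csumD T (u v : T -> R) : (forall i, 0 <= u i) -> (forall i, 0 <= v i) ->
  asum u -> asum v -> csum (fun i => u i + v i) = csum u + csum v.
Proof.
move=> u0 v0 su sv; apply: EFin_inj; rewrite EFinD -!esum_csum//.
- by rewrite -esumD; [apply: eq_esum => i _; rewrite EFinD|move=> i _; rewrite lee_fin..].
- by move=> i; rewrite addr_ge0.
- exact: asumD.
Qed.

Lemma csum_posneg T (u : T -> R) : asum u ->
  csum u = csum (fun i => Num.max (u i) 0) - csum (fun i => Num.max (- u i) 0).
Proof.
have m0 (w : T -> R) i : 0 <= Num.max (w i) 0 by exact: max0_ge0.
move=> su; apply: EFin_inj; rewrite EFinB -csum_def_fin//.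
rewrite (esum_csum (m0 u) (asum_pos su)).
by rewrite (esum_csum (m0 (fun i => - u i)) (asum_pos (asumN su))).
Qed.

(** The sum may be computed from any splitting into nonnegative summable families, not only from
    positive and negative parts: in [u^+ + q = p + u^-] both sides are nonnegative, so the
    additivity already known applies. Linearity of [csum] reduces to exhibiting such splittings. *)
Lemma csum_diff T (u p q : T -> R) : (forall i, 0 <= p i) -> (forall i, 0 <= q i) ->
  asum p -> asum q -> (forall i, u i = p i - q i) -> csum u = csum p - csum q.
Proof.
have m0 (w : T -> R) i : 0 <= Num.max (w i) 0 by exact: max0_ge0.
move=> p0 q0 sp sq uE.
have su : asum u by rewrite (funext uE); apply: asumB.
have sn := asum_pos (asumN su).
have h1 := ge0_csumD (m0 u) q0 (asum_pos su) sq.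
have h2 := ge0_csumD p0 (m0 (fun i => - u i)) sp sn.
have E : csum (fun i => Num.max (u i) 0 + q i) = csum (fun i => p i + Num.max (- u i) 0).
  congr csum; apply/funext => i; rewrite uE opprB.
  by case: (leP (p i - q i) 0) => h; case: (leP (q i - p i) 0) => h'; lra.
by rewrite csum_posneg//; lra.
Qed.

Lemma csumD T (u v : T -> R) : asum u -> asum v ->
  csum (fun i => u i + v i) = csum u + csum v.
Proof.
move=> su sv; have [su' sv'] := (asumN su, asumN sv).
rewrite (csum_posneg su) (csum_posneg sv).
rewrite (@csum_diff _ _ (fun i => Num.max (u i) 0 + Num.max (v i) 0)
   (fun i => Num.max (- u i) 0 + Num.max (- v i) 0)).
- have h1 := ge0_csumD (fun i => max0_ge0 (u i)) (fun i => max0_ge0 (v i)) (asum_pos su) (asum_pos sv).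
  have h2 := ge0_csumD (fun i => max0_ge0 (- u i)) (fun i => max0_ge0 (- v i)) (asum_pos su') (asum_pos sv').
  by rewrite h1 h2; lra.
- by move=> i; rewrite addr_ge0 ?max0_ge0.
- by move=> i; rewrite addr_ge0 ?max0_ge0.
- by apply: asumD; exact: asum_pos.
- by apply: asumD; [exact: (asum_pos su')|exact: (asum_pos sv')].
- move=> i; have E (x : R) : x = Num.max x 0 - Num.max (- x) 0.
    by case: (leP 0 x) => h; case: (leP 0 (- x)) => h'; lra.
  by rewrite {1}(E (u i)) {1}(E (v i)); ring.
Qed.

Lemma csumN T (u : T -> R) : asum u -> csum (fun i => - u i) = - csum u.
Proof.
move=> su; rewrite (csum_posneg su) (csum_posneg (asumN su)).
by under [X in _ - csum X]eq_fun do rewrite opprK; rewrite opprB.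
Qed.

Lemma csumB T (u v : T -> R) : asum u -> asum v ->
  csum (fun i => u i - v i) = csum u - csum v.
Proof. by move=> su sv; rewrite csumD ?csumN//; exact: asumN. Qed.

Lemma csumZ T c (u : T -> R) : asum u -> csum (fun i => c * u i) = c * csum u.
Proof.
have key b (v : T -> R) : 0 <= b -> asum v -> csum (fun i => b * v i) = b * csum v.
  move=> b0 sv; rewrite (csum_posneg sv).
  have [sp sn] := (asum_pos sv, asum_pos (asumN sv)).
  rewrite mulrBr (@csum_diff _ _ (fun i => b * Num.max (v i) 0)
     (fun i => b * Num.max (- v i) 0)).
  - have E (w : T -> R) : (forall i, 0 <= w i) -> asum w ->
        csum (fun i => b * w i) = b * csum w.
      move=> w0 sw; apply: EFin_inj; rewrite EFinM -!esum_csum ?esumZl//.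
        by move=> i; rewrite mulr_ge0.
      exact: asumZ.
    by rewrite (E _ (fun i => max0_ge0 (v i)) sp) (E _ (fun i => max0_ge0 (- v i)) sn).
  - by move=> i; rewrite mulr_ge0 ?max0_ge0.
  - by move=> i; rewrite mulr_ge0 ?max0_ge0.
  - exact: asumZ.
  - exact: asumZ.
  - move=> i; rewrite -mulrBr; congr (_ * _).
    by case: (leP 0 (v i)) => h; case: (leP 0 (- v i)) => h'; lra.
move=> su; have [c0|c0] := leP 0 c; first exact: key.
rewrite -[RHS]opprK -mulNr -key// ?oppr_ge0 ?ltW// -csumN; last exact: asumZ.
by congr csum; apply/funext => i; rewrite mulNr opprK.
Qed.

Lemma csum_ge0 T (u : T -> R) : (forall i, 0 <= u i) -> 0 <= csum u.
Proof.
by move=> u0; rewrite csum_ge0E// fine_ge0// esum_ge0// => i _; rewrite lee_fin.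
Qed.

Lemma le_csum T (u v : T -> R) : asum u -> asum v -> (forall i, u i <= v i) ->
  csum u <= csum v.
Proof.
move=> su sv uv; rewrite -subr_ge0 -csumB//.
by apply: csum_ge0 => i; rewrite subr_ge0.
Qed.

Lemma ler_abs_csum T (u : T -> R) : asum u -> `|csum u| <= csum (fun i => `|u i|).
Proof.
move=> su; have sa := asum_abs su.
rewrite ler_norml; apply/andP; split.
  rewrite -csumN//; apply: le_csum => // [|i]; first exact: (asumN sa).
  by have := ler_norm (- u i); rewrite normrN; lra.
by apply: le_csum => // i; exact: ler_norm.
Qed.

Lemma csum_ge1 T (u : T -> R) i : (forall j, 0 <= u j) -> asum u -> u i <= csum u.
Proof.
move=> u0 su; rewrite -lee_fin -esum_csum//.
have e0 : forall j, [set: T] j -> (0 <= (u j)%:E)%E by move=> j _; rewrite lee_fin.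
rewrite (esumID [set i]) ?setTI//.
by rewrite esum_set1 ?lee_fin// leeDl// esum_ge0// => j _; rewrite lee_fin.
Qed.

Lemma asum_reindex T T' (e : T -> T') (u : T' -> R) : bijective e ->
  asum u -> asum (fun i => u (e i)).
Proof.
by rewrite -setTT_bijective => be; rewrite /asum (reindex_esum [set: T] _ e).
Qed.

Lemma csum_reindex T T' (e : T -> T') (u : T' -> R) : bijective e ->
  csum (fun i => u (e i)) = csum u.
Proof.
by rewrite -setTT_bijective => be; rewrite /csum !(reindex_esum [set: T] [set: T'] e).
Qed.

(** Tonelli as a criterion of summability over a product. *)
Lemma asum_pair T T' (F : T * T' -> R) :
  (forall i, asum (fun j => F (i, j))) ->
  asum (fun i => csum (fun j => `|F (i, j)|)) -> asum F.
Proof.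
move=> s1; rewrite /asum => s2.
rewrite (_ : [set: T * T'] = [set: T] `*`` (fun=> [set: T'])); last first.
  by apply/seteqP; split.
rewrite (eq_esum (b := fun k => `|F (k.1, k.2)|%:E)); last by move=> [].
rewrite -(@esum_esum _ _ _ _ _ (fun i j => `|F (i, j)|%:E)); last first.
  by move=> *; rewrite lee_fin.
apply: le_lt_trans s2; apply: le_esum => i _.
rewrite esum_csum//; last exact/asum_abs/s1.
by rewrite lee_fin ler_norm.
Qed.

Lemma ge0_csum_pair T T' (F : T * T' -> R) : (forall k, 0 <= F k) -> asum F ->
  [/\ forall i, asum (fun j => F (i, j)), asum (fun i => csum (fun j => F (i, j))) &
   csum F = csum (fun i => csum (fun j => F (i, j)))].
Proof.
move=> F0 sF.
have E : \esum_(i in [set: T]) \esum_(j in [set: T']) (F (i, j))%:E =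
         \esum_(k in [set: T * T']) (F k)%:E.
  rewrite (@esum_esum _ _ _ _ (fun=> [set: T']) (fun i j => (F (i, j))%:E)); last first.
    by move=> *; rewrite lee_fin.
  rewrite (_ : _ `*`` _ = [set: T * T']); last by apply/seteqP; split.
  by apply: eq_esum => -[].
have s1 i : asum (fun j => F (i, j)).
  rewrite /asum; under eq_esum do rewrite ger0_norm//.
  apply: (@le_lt_trans _ _ (\esum_(k in [set: T * T']) (F k)%:E)).
    rewrite -E (esumID [set i]); last first.
      by move=> j _; apply: esum_ge0 => k _; rewrite lee_fin.
    rewrite setTI esum_set1; last by apply: esum_ge0 => k _; rewrite lee_fin.
    by rewrite leeDl// esum_ge0// => j _; apply: esum_ge0 => k _; rewrite lee_fin.
  by rewrite esum_csum// ltry.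
have E' : \esum_(i in [set: T]) (csum (fun j => F (i, j)))%:E = (csum F)%:E.
  by rewrite -esum_csum// -E; apply: eq_esum => i _; rewrite -esum_csum.
have s2 : asum (fun i => csum (fun j => F (i, j))).
  rewrite /asum; under eq_esum do rewrite ger0_norm ?csum_ge0//.
  by rewrite E' ltry.
split => //; apply: EFin_inj; rewrite -E' esum_csum// => i.
exact: csum_ge0.
Qed.

(** Fubini: the nonnegative case, applied to the positive and the negative part and subtracted. *)
Lemma csum_pair T T' (F : T * T' -> R) : asum F ->
  [/\ forall i, asum (fun j => F (i, j)), asum (fun i => csum (fun j => F (i, j))) &
   csum F = csum (fun i => csum (fun j => F (i, j)))].
Proof.
have m0 (w : T * T' -> R) : forall i, 0 <= Num.max (w i) 0.
  by move=> i; rewrite le_max lexx orbT.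
move=> sF; have [sp sn] := (asum_pos sF, asum_pos (asumN sF)).
have [p1 p2 p3] := ge0_csum_pair (m0 _) sp.
have [n1 n2 n3] := ge0_csum_pair (m0 _) sn.
have [a1 _ _] := ge0_csum_pair (fun k => normr_ge0 _) (asum_abs sF).
have s1 i : asum (fun j => F (i, j)).
  by apply: asum_le (a1 i) => j; rewrite normr_id.
have E i : csum (fun j => F (i, j)) = csum (fun j => Num.max (F (i, j)) 0) -
    csum (fun j => Num.max (- F (i, j)) 0).
  exact: csum_posneg.
split => //.
  by rewrite (funext E); apply: asumB.
by rewrite csum_posneg// p3 n3 -csumB// (funext E).
Qed.

Lemma csum_swap T T' (F : T * T' -> R) : asum F ->
  csum (fun i => csum (fun j => F (i, j))) = csum (fun j => csum (fun i => F (i, j))).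
Proof.
move=> sF; pose e (k : T' * T) := (k.2, k.1).
have be : bijective e by exists (fun k => (k.2, k.1)) => -[].
have [_ _ <-] := csum_pair sF; rewrite -(csum_reindex F be).
by have [_ _ ->] := csum_pair (asum_reindex be sF).
Qed.

Lemma asum_prod T T' (u : T -> R) (v : T' -> R) : asum u -> asum v ->
  asum (fun k : T * T' => u k.1 * v k.2).
Proof.
move=> su sv; apply: asum_pair => //= [i|]; first exact: asumZ.
rewrite (_ : (fun i => _) = (fun i => csum (fun j => `|v j|) * `|u i|)).
  exact/asumZ/asum_abs.
apply/funext => i; under eq_fun do rewrite normrM.
by rewrite csumZ 1?mulrC//; exact: asum_abs.
Qed.

Lemma csum_prod T T' (u : T -> R) (v : T' -> R) : asum u -> asum v ->
  csum (fun k : T * T' => u k.1 * v k.2) = csum u * csum v.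
Proof.
move=> su sv; have [_ _ ->/=] := csum_pair (asum_prod su sv).
under eq_fun do rewrite csumZ// mulrC.
by rewrite csumZ// mulrC.
Qed.

Lemma asum_single T (t : T) (c : R) : asum (fun i => if i == t then c else 0).
Proof.
rewrite /asum (esumID [set t]); last by move=> *; rewrite lee_fin.
rewrite setTI esum_set1 ?lee_fin// eqxx esum1 ?adde0 ?ltry//.
by move=> i [_ /= /eqP/negbTE ->]; rewrite normr0.
Qed.

Lemma csum_single T (t : T) (c : R) : csum (fun i => if i == t then c else 0) = c.
Proof.
rewrite (_ : (fun i => _) = (fun i => c * (if i == t then 1 else 0))); last first.
  by apply/funext => i; case: ifP; rewrite ?mulr1 ?mulr0.
rewrite csumZ; last exact: asum_single.
rewrite csum_ge0E; last by move=> i; case: ifP.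
rewrite (esumID [set t]); last by move=> i _; rewrite lee_fin; case: ifP.
rewrite setTI esum_set1 eqxx ?lee_fin// esum1 ?adde0 ?mulr1//.
by move=> i [_ /= /eqP/negbTE ->].
Qed.

End Summation.

(** * Convolution and discrete derivatives on Z *)

Section Convolution.
Context {R : realType}.
Implicit Types (u v g h : int -> R).

Definition l1 u : R := csum (fun k => `|u k|).

Definition dif (d : int) u (k : int) : R := u (k - d) - u k.

(** Convolution with the law of a fair coin worth [0] or [d]. *)
Definition avg (d : int) u (k : int) : R := (u k + u (k - d)) / 2.

Lemma subr_bij (c : int) : bijective (fun k : int => k - c).
Proof. by exists (fun k => k + c) => k; rewrite ?subrK ?addrK. Qed.

Lemma csum_shift (c : int) u : csum (fun k => u (k - c)) = csum u.
Proof. exact: csum_reindex (subr_bij c). Qed.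

Lemma asum_shift (c : int) u : asum u -> asum (fun k => u (k - c)).
Proof. exact: asum_reindex (subr_bij c). Qed.

Lemma asum_dif d u : asum u -> asum (dif d u).
Proof. by move=> su; apply: asumB => //; exact: asum_shift. Qed.

Lemma asum_avg d u : asum u -> asum (avg d u).
Proof.
move=> su; rewrite /avg; under eq_fun do rewrite mulrC.
by apply: asumZ; apply: asumD => //; exact: asum_shift.
Qed.

Lemma asum_iter_avg d j u : asum u -> asum (iter j (avg d) u).
Proof. by move=> su; elim: j => //= j IH; exact: asum_avg. Qed.

Lemma l1_ge0 u : 0 <= l1 u.
Proof. exact: csum_ge0. Qed.

Lemma l1_ge u k : asum u -> `|u k| <= l1 u.
Proof. by move=> su; apply: (@csum_ge1 _ _ (fun k => `|u k|)) => //; exact: asum_abs. Qed.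

Lemma ler_l1D u v : asum u -> asum v -> l1 (fun k => u k + v k) <= l1 u + l1 v.
Proof.
move=> su sv; have [sa sb] := (asum_abs su, asum_abs sv).
rewrite -csumD//; apply: le_csum => [| |k]; last exact: ler_normD.
  exact/asum_abs/asumD.
exact: asumD.
Qed.

Lemma l1N u : l1 (fun k => - u k) = l1 u.
Proof. by congr csum; apply/funext => k; rewrite normrN. Qed.

Lemma l1Z c u : asum u -> l1 (fun k => c * u k) = `|c| * l1 u.
Proof.
move=> su; rewrite -csumZ; last exact: asum_abs.
by congr csum; apply/funext => k; rewrite normrM.
Qed.

Lemma l1_shift c u : l1 (fun k => u (k - c)) = l1 u.
Proof. exact: (csum_shift c (fun k => `|u k|)). Qed.

Lemma zconvE u v k : zconv u v k = csum (fun j => u (k - j) * v j).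
Proof. by []. Qed.

Lemma asum_conv_row g v k : asum g -> asum v -> asum (fun j => g (k - j) * v j).
Proof.
move=> sg sv; apply: asum_le (asumZ (l1 g) sv) => j.
by rewrite !normrM ler_wpM2r// (ger0_norm (l1_ge0 g)) l1_ge.
Qed.

(** The shear [(k, j) -> (k - j, j)] is a bijection of the plane, so Fubini turns the sum of [phi]
    against a convolution into a double sum. It serves with [phi = 1] for total masses and with
    [phi = k^2] for second moments. *)
Lemma csum_conv (phi : int -> R) g v : asum g -> asum v ->
  asum (fun p : int * int => phi (p.1 + p.2) * (g p.1 * v p.2)) ->
  asum (fun k => phi k * zconv g v k) /\
  csum (fun k => phi k * zconv g v k) =
    csum (fun p : int * int => phi (p.1 + p.2) * (g p.1 * v p.2)).
Proof.
move=> sg sv sp; pose e (p : int * int) := (p.1 - p.2, p.2).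
have be : bijective e.
  by exists (fun p => (p.1 + p.2, p.2)) => -[i j]; rewrite /e /= ?subrK ?addrK.
rewrite -(csum_reindex _ be).
have [_] := csum_pair (asum_reindex be sp).
have E k : csum (fun j => phi ((e (k, j)).1 + (e (k, j)).2) *
   (g (e (k, j)).1 * v (e (k, j)).2)) = phi k * zconv g v k.
  rewrite zconvE -csumZ; last exact: asum_conv_row.
  by congr csum; apply/funext => j; rewrite /e /= subrK.
by rewrite (funext E).
Qed.

Lemma asum_conv g v : asum g -> asum v -> asum (zconv g v).
Proof.
move=> sg sv; have [|+ _] := @csum_conv (fun=> 1) g v sg sv.
  by under eq_fun do rewrite mul1r; exact: asum_prod.
by under eq_fun do rewrite mul1r.
Qed.

Lemma csum_conv1 g v : asum g -> asum v -> csum (zconv g v) = csum g * csum v.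
Proof.
move=> sg sv; have [|_] := @csum_conv (fun=> 1) g v sg sv.
  by under eq_fun do rewrite mul1r; exact: asum_prod.
under eq_fun do rewrite mul1r.
by under [in X in _ = X -> _]eq_fun do rewrite mul1r; rewrite csum_prod.
Qed.

Lemma zconv_ge0 g v k : (forall k, 0 <= g k) -> (forall k, 0 <= v k) -> 0 <= zconv g v k.
Proof. by move=> g0 v0; apply: csum_ge0 => j; rewrite mulr_ge0. Qed.

(** The absolute value of a convolution is at most the convolution of the absolute values, and total
    mass is multiplicative. *)
Lemma l1_conv g v : asum g -> asum v -> l1 (zconv g v) <= l1 g * l1 v.
Proof.
move=> sg sv; have [sa sb] := (asum_abs sg, asum_abs sv).
rewrite -csum_conv1//; apply: le_csum => [| |k].
- exact/asum_abs/asum_conv.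
- exact: asum_conv.
- apply: le_trans (ler_abs_csum (asum_conv_row k sg sv)) _.
  by rewrite zconvE; under eq_fun do rewrite normrM.
Qed.

Lemma zconvDl g h v : asum g -> asum h -> asum v ->
  zconv (fun k => g k + h k) v = (fun k => zconv g v k + zconv h v k).
Proof.
move=> sg sh sv; apply/funext => k; rewrite !zconvE -csumD; [|exact: asum_conv_row..].
by congr csum; apply/funext => j; rewrite mulrDl.
Qed.

Lemma zconvDr g h v : asum g -> asum h -> asum v ->
  zconv v (fun k => g k + h k) = (fun k => zconv v g k + zconv v h k).
Proof.
move=> sg sh sv; apply/funext => k; rewrite !zconvE -csumD; [|exact: asum_conv_row..].
by congr csum; apply/funext => j; rewrite mulrDr.
Qed.

Lemma zconvZl c g v : asum g -> asum v ->
  zconv (fun k => c * g k) v = (fun k => c * zconv g v k).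
Proof.
move=> sg sv; apply/funext => k; rewrite !zconvE -csumZ; last exact: asum_conv_row.
by congr csum; apply/funext => j; rewrite mulrA.
Qed.

Lemma zconvZr c g v : asum g -> asum v ->
  zconv g (fun k => c * v k) = (fun k => c * zconv g v k).
Proof.
move=> sg sv; apply/funext => k; rewrite !zconvE -csumZ; last exact: asum_conv_row.
by congr csum; apply/funext => j; rewrite mulrCA.
Qed.

Lemma zconv_shiftl c g v : zconv (fun k => g (k - c)) v = (fun k => zconv g v (k - c)).
Proof.
by apply/funext => k; congr csum; apply/funext => j; rewrite addrAC.
Qed.

Lemma zconv_shiftr c g v : zconv g (fun k => v (k - c)) = (fun k => zconv g v (k - c)).
Proof.
apply/funext => k; rewrite !zconvE -[RHS](csum_shift c).
by congr csum; apply/funext => j; congr (g _ * _); ring.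
Qed.

Lemma dif_convl d g v : asum g -> asum v -> dif d (zconv g v) = zconv (dif d g) v.
Proof.
move=> sg sv; rewrite /dif zconvDl//; last first.
- exact: asumN.
- exact: asum_shift.
rewrite zconv_shiftl; apply/funext => k; congr (_ + _).
under [in RHS]eq_fun do rewrite -mulN1r.
by rewrite zconvZl// mulN1r.
Qed.

Lemma dif_convr d g v : asum g -> asum v -> dif d (zconv g v) = zconv g (dif d v).
Proof.
move=> sg sv; rewrite /dif zconvDr//; last first.
- exact: asumN.
- exact: asum_shift.
rewrite zconv_shiftr; apply/funext => k; congr (_ + _).
under [in RHS]eq_fun do rewrite -mulN1r.
by rewrite zconvZr// mulN1r.
Qed.

Lemma avg_conv d g v : asum g -> asum v -> avg d (zconv g v) = zconv (avg d g) v.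
Proof.
move=> sg sv; rewrite /avg.
under [in RHS]eq_fun do rewrite mulrC.
rewrite zconvZl//; last by apply: asumD => //; exact: asum_shift.
rewrite zconvDl//; last exact: asum_shift.
by rewrite zconv_shiftl; apply/funext => k; rewrite mulrC.
Qed.

Lemma iter_avg_conv d j g v : asum g -> asum v ->
  iter j (avg d) (zconv g v) = zconv (iter j (avg d) g) v.
Proof.
move=> sg sv; elim: j => //= j ->; rewrite avg_conv//.
exact: asum_iter_avg.
Qed.

Lemma zconv_single g s c : zconv g (fun k => if k == s then c else 0) = (fun k => c * g (k - s)).
Proof.
apply/funext => k; rewrite zconvE.
under eq_fun => j.
  rewrite (_ : _ * _ = if j == s then c * g (k - s) else 0); last first.
    by case: eqP => [->|]; rewrite ?mulr0// mulrC.
  over.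
by rewrite csum_single.
Qed.

Definition prob_mass v := [/\ forall k, 0 <= v k, asum v & csum v = 1].

Lemma l1_prob v : prob_mass v -> l1 v = 1.
Proof.
by case=> v0 _ <-; congr csum; apply/funext => k; rewrite ger0_norm.
Qed.

Lemma prob_mass_conv u v : prob_mass u -> prob_mass v -> prob_mass (zconv u v).
Proof.
move=> [u0 su u1] [v0 sv v1]; split; first by move=> k; exact: zconv_ge0.
  exact: asum_conv.
by rewrite csum_conv1// u1 v1 mulr1.
Qed.

(* Splitting off the two atoms, v = dl (delta_s + delta_(s+d)) + q, the first
   summand acts on g as a translate of 2 dl (avg d g). *)
Lemma l1_conv_two_atoms (dl : R) (d s : int) g v : asum g -> prob_mass v -> d != 0 ->
  0 <= dl -> dl <= v s -> dl <= v (s + d) ->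
  l1 (zconv g v) <= 2 * dl * l1 (avg d g) + (1 - 2 * dl) * l1 g.
Proof.
move=> sg [v0 sv v1] d0 dl0 vs vsd.
pose e (t k : int) : R := if k == t then dl else 0.
have se t : asum (e t) by exact: asum_single.
pose q k := v k - (e s k + e (s + d) k).
have sq : asum q by apply: asumB => //; exact: asumD.
(* Since [d != 0], the points [s] and [s + d] differ, so at each [k] at most one of the two atoms is
   removed. *)
have q0 k : 0 <= q k.
  rewrite /q /e; case: eqP => [->|_].
    rewrite ifF; first by rewrite addr0 subr_ge0.
    by apply/negbTE; rewrite -subr_eq0 opprD addrA subrr sub0r oppr_eq0.
  by case: eqP => [->|_]; rewrite ?add0r subr_ge0.
have lq : l1 q = 1 - 2 * dl.
  have -> : l1 q = csum q by congr csum; apply/funext => k; rewrite ger0_norm.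
  rewrite csumB//; last exact: asumD.
  by rewrite csumD// !csum_single v1; ring.
have E : zconv g v = (fun k => 2 * dl * avg d g (k - s) + zconv g q k).
  have -> : v = (fun k => (e s k + e (s + d) k) + q k).
    by apply/funext => k; rewrite /q addrC subrK.
  rewrite zconvDr//; last exact: asumD.
  rewrite zconvDr// !zconv_single; apply/funext => k; congr (_ + _).
  by rewrite /avg (_ : k - (s + d) = k - s - d); [field|ring].
rewrite E; apply: le_trans (ler_l1D _ _) _.
- by apply: asumZ; apply: (@asum_shift s); exact: asum_avg.
- exact: asum_conv.
rewrite l1Z; last by apply: (@asum_shift s); exact: asum_avg.
rewrite l1_shift ger0_norm ?mulr_ge0// lerD2l.
by rewrite -lq mulrC; exact: l1_conv.
Qed.

(** * Binomial kernels and coin flips hidden in a convolution product *)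

Local Notation delta0 := (@Defs.dirac0 R).

Lemma asum_dirac0 : asum delta0.
Proof. exact: asum_single. Qed.

Lemma prob_mass_dirac0 : prob_mass delta0.
Proof.
split; [by move=> k; rewrite /Defs.dirac0; case: ifP|exact: asum_dirac0|exact: csum_single].
Qed.

(** The [j]-fold average of the unit mass is the binomial law with step [d]. This is the identity
    [C(j,i-1) - C(j,i) = (2i-j-1)/(j+1) C(j+1,i)] at [k = d i], in a form without division that also
    holds for the other [k]. *)
Lemma dif_iter_avg_dirac (d : int) j (k : int) :
  d%:~R * j.+1%:R * dif d (iter j (avg d) delta0) k =
  2 * (2 * k%:~R - d%:~R * j.+1%:R) * iter j.+1 (avg d) delta0 k.
Proof.
elim: j k => [|j IH] k.
  rewrite /= /dif /avg /Defs.dirac0.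
  have [->|k0] := eqVneq k 0; have [/eqP|kd] := eqVneq (_ - d) 0.
  - by rewrite sub0r oppr_eq0 => /eqP ->; ring.
  - by field.
  - by rewrite subr_eq0 => /eqP ->; field.
  - by ring.
set h := iter j.+1 (avg d) delta0 in IH *.
have Ed : d%:~R * j.+1%:R * dif d h k =
   (2 * k%:~R - d%:~R * j.+1%:R) * h k + (2 * (k - d)%:~R - d%:~R * j.+1%:R) * h (k - d).
  have -> : dif d h k = (dif d (iter j (avg d) delta0) k + dif d (iter j (avg d) delta0) (k - d)) / 2.
    by rewrite /h /= /dif /avg; field.
  have := IH k; have := IH (k - d).
  lra.
rewrite (_ : iter j.+2 (avg d) delta0 k = (h k + h (k - d)) / 2)//.
have -> : d%:~R * j.+2%:R * dif d h k = d%:~R * j.+1%:R * dif d h k + d%:~R * dif d h k.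
  by rewrite -[j.+2]addn1 natrD; ring.
by rewrite Ed /dif rmorphB /= -[j.+2]addn1 natrD; field.
Qed.

(** Twice a binomial variable with step [d] has mean [d j] and variance [d^2 j]. The center [t] is
    kept free because one more average brings in the center [t - 2 d]. *)
Lemma iter_avg_second_moment (d : int) j :
  let h := iter j (avg d) delta0 in
  forall t : R, asum (fun k : int => (2 * k%:~R - t) ^+ 2 * h k) /\
    csum (fun k : int => (2 * k%:~R - t) ^+ 2 * h k) =
      (d%:~R * j%:R - t) ^+ 2 + d%:~R ^+ 2 * j%:R.
Proof.
move=> h; rewrite {}/h; elim: j => [|j IH] t.
  have E : (fun k : int => (2 * k%:~R - t) ^+ 2 * delta0 k) =
     (fun k => if k == 0 then t ^+ 2 else 0).
    apply/funext => k; rewrite /Defs.dirac0; case: eqP => [->|_]; last by rewrite mulr0.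
    by rewrite mulr1 mulr0 sub0r sqrrN.
  by rewrite /= E csum_single; split; [exact: asum_single|ring].
set h := iter j (avg d) delta0 in IH *.
have [s1 e1] := IH t; have [s2 e2] := IH (t - 2 * d%:~R).
have E : (fun k : int => (2 * k%:~R - t) ^+ 2 * avg d h k) =
   (fun k : int => 2^-1 * ((2 * k%:~R - t) ^+ 2 * h k) +
     2^-1 * ((2 * (k - d)%:~R - (t - 2 * d%:~R)) ^+ 2 * h (k - d))).
  by apply/funext => k; rewrite /avg rmorphB /=; field.
have s3 := asum_shift d s2; rewrite /= E; split.
  by apply: asumD; exact: asumZ.
rewrite csumD; [|exact: asumZ..].
rewrite !csumZ// e1 (csum_shift d (fun k => (2 * k%:~R - (t - 2 * d%:~R)) ^+ 2 * h k)) e2.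
by rewrite -[j.+1]addn1 natrD; field.
Qed.

Lemma iter_avg_prob d j : prob_mass (iter j (avg d) delta0).
Proof.
elim: j => [|j [h0 sh h1]] /=; first exact: prob_mass_dirac0.
split; [|exact: asum_avg|].
  by move=> k; rewrite /avg divr_ge0// addr_ge0.
rewrite /avg; under eq_fun do rewrite mulrC.
have ss := asum_shift d sh.
by rewrite csumZ ?csumD//; [rewrite csum_shift h1; field|exact: asumD].
Qed.

(** By the binomial identity the norm is [2 / (|d| (j+1))] times the mean absolute deviation of
    twice the binomial variable with [j+1] steps, which is at most its standard deviation
    [|d| sqrt (j+1)]. *)
Lemma l1_dif_iter_avg_dirac (d : int) j : d != 0 ->
  l1 (dif d (iter j (avg d) delta0)) <= 2 / Num.sqrt j.+1%:R.
Proof.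
move=> d0; set h := iter j.+1 (avg d) delta0.
have [h0 sh h1] := iter_avg_prob d j.+1; rewrite -/h in h0 sh h1.
have D0 : 0 < `|d%:~R : R| by rewrite normr_gt0 intr_eq0.
set D := `|d%:~R : R| in D0.
set r : R := Num.sqrt j.+1%:R.
have r0 : 0 < r by rewrite sqrtr_gt0 ltr0n.
have rr : r ^+ 2 = j.+1%:R by rewrite sqr_sqrtr ?ler0n.
have [sm em] := iter_avg_second_moment d j.+1 (d%:~R * j.+1%:R); rewrite -/h in sm em.
(* In place of Cauchy-Schwarz: [2 |y| <= y^2 / (D r) + D r], balanced at the standard deviation
   [D r]. *)
pose b (k : int) := (D * r ^+ 2)^-1 * ((D * r)^-1 * ((2 * k%:~R - d%:~R * j.+1%:R) ^+ 2 * h k) +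
   D * r * h k).
have sb : asum b by apply: asumZ; apply: asumD; exact: asumZ.
apply: (@le_trans _ _ (csum b)).
  apply: le_csum => // [|k].
    by apply/asum_abs/asum_dif/asum_iter_avg/asum_dirac0.
  have := dif_iter_avg_dirac d j k; rewrite -/h -rr => E.
  have E2 : D * r ^+ 2 * `|dif d (iter j (avg d) delta0) k| =
      2 * `|2 * k%:~R - d%:~R * r ^+ 2| * h k.
    move/(congr1 Num.norm): E; rewrite [LHS]normrM [X in X * _]normrM.
    rewrite (ger0_norm (sqr_ge0 r)) => ->; rewrite [LHS]normrM [X in X * _]normrM.
    by rewrite (ger0_norm (h0 k)) (@ger0_norm _ 2).
  rewrite /b ler_pdivlMl ?mulr_gt0 ?exprn_gt0// E2 -rr.
  set y := 2 * k%:~R - _; rewrite [leRHS](_ : _ = ((D * r)^-1 * y ^+ 2 + D * r) * h k); last ring.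
  rewrite ler_wpM2r// -[y ^+ 2]real_normK ?num_real//.
  rewrite -subr_ge0 (_ : _ - _ = (D * r)^-1 * (`|y| - D * r) ^+ 2); last first.
    by field; rewrite !gt_eqF.
  by rewrite mulr_ge0 ?sqr_ge0// invr_ge0 mulr_ge0 ?ltW.
rewrite csumZ; last by apply: asumD; exact: asumZ.
rewrite csumD; [|exact: asumZ..].
rewrite !csumZ// em h1 subrr expr0n /= add0r -rr -[d%:~R ^+ 2]real_normK ?num_real// -/D.
by rewrite le_eqVlt; apply/orP; left; apply/eqP; field; rewrite !gt_eqF.
Qed.

(** For [x >= 1], moving from [x] to [x + 1] lowers [1 / sqrt x] by at least [x^(-3/2) / 4], while
    moving to [x + dl / 2] lowers it by at most [dl x^(-3/2) / 4]. The first drop, taken with weight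
    [2 dl], exceeds the second. *)
Lemma inv_sqrt_step (dl x : R) : 1 <= x -> 0 <= dl ->
  2 * dl * (Num.sqrt (x + 1))^-1 + (1 - 2 * dl) * (Num.sqrt x)^-1 <=
    (Num.sqrt (x + dl / 2))^-1.
Proof.
move=> x1 dl0.
set A := Num.sqrt x; set B := Num.sqrt (x + 1); set C := Num.sqrt (x + dl / 2).
have A0 : 0 < A by rewrite sqrtr_gt0; lra.
have B0 : 0 < B by rewrite sqrtr_gt0; lra.
have C0 : 0 < C by rewrite sqrtr_gt0; lra.
have AA : A ^+ 2 = x by rewrite sqr_sqrtr; lra.
have BB : B ^+ 2 = x + 1 by rewrite sqr_sqrtr; lra.
have CC : C ^+ 2 = x + dl / 2 by rewrite sqr_sqrtr; lra.
have AC : A <= C by rewrite ler_sqrt; lra.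
have e1 : A^-1 - C^-1 = (C ^+ 2 - A ^+ 2) / (A * C * (A + C)).
  by field; rewrite !gt_eqF// addr_gt0.
have e2 : A^-1 - B^-1 = (B ^+ 2 - A ^+ 2) / (A * B * (A + B)).
  by field; rewrite !gt_eqF// addr_gt0.
have l1 : A^-1 - C^-1 <= dl / 2 / (2 * A ^+ 3).
  rewrite e1 CC AA (_ : x + dl / 2 - x = dl / 2); last ring.
  apply: ler_wpM2l; first by lra.
  rewrite lef_pV2 ?posrE ?mulr_gt0 ?addr_gt0 ?exprn_gt0//.
  have : A * A <= A * C by rewrite ler_pM2l.
  move=> h; rewrite (_ : 2 * A ^+ 3 = A * A * (A + A)); last ring.
  by apply: ler_pM; rewrite ?mulr_ge0 ?addr_ge0 ?lerD// ltW.
have l2 : 1 / (4 * A ^+ 3) <= A^-1 - B^-1.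
  rewrite e2 BB AA (_ : x + 1 - x = 1); last ring.
  apply: ler_wpM2l => //.
  rewrite lef_pV2 ?posrE ?mulr_gt0 ?addr_gt0 ?exprn_gt0//.
  rewrite (_ : A * B * (A + B) = A * (A * B + B ^+ 2)); last ring.
  rewrite (_ : 4 * A ^+ 3 = A * (4 * A ^+ 2)); last ring.
  rewrite ler_pM2l//; have := sqr_ge0 (A - B); rewrite sqrrB; lra.
have := ler_wpM2l (mulr_ge0 (ler0n _ 2) dl0) l2.
rewrite (_ : dl / 2 / (2 * A ^+ 3) = dl / 4 / A ^+ 3) in l1; last first.
  by field; rewrite !gt_eqF.
rewrite (_ : 2%:R * dl * (1 / (4 * A ^+ 3)) = dl / 2 / A ^+ 3); last first.
  by field; rewrite !gt_eqF.
have : 0 <= dl / 4 / A ^+ 3 by rewrite !divr_ge0// exprn_ge0// ltW.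
have -> : dl / 2 / A ^+ 3 = dl / 4 / A ^+ 3 + dl / 4 / A ^+ 3 by field; rewrite gt_eqF.
lra.
Qed.

Lemma convpow_prob (nu : nat -> int -> R) n :
  (forall i, (1 <= i)%N -> prob_mass (nu i)) -> prob_mass (convpow nu n).
Proof.
move=> pnu; elim: n => [|n IH] /=; first exact: prob_mass_dirac0.
by apply: prob_mass_conv => //; exact: pnu.
Qed.

(** The last factor is peeled off first, and [j] counts the coin flips collected so far. A good
    factor either yields one more flip, with weight [2 dl], or leaves [j] unchanged; by
    [inv_sqrt_step] it counts for at least [dl / 2] of a flip. Other factors do not increase the
    norm. *)
Lemma l1_dif_avg_convpow (nu : nat -> int -> R) (good : nat -> bool) (d : int) (dl : R) n j :
  (forall i, (1 <= i)%N -> prob_mass (nu i)) -> d != 0 -> 0 <= dl ->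
  (forall i, (1 <= i)%N -> good i -> exists2 s, dl <= nu i s & dl <= nu i (s + d)) ->
  l1 (dif d (iter j (avg d) (convpow nu n))) <=
    2 / Num.sqrt (j.+1%:R + dl / 2 * (\sum_(1 <= i < n.+1) good i)%:R).
Proof.
move=> pnu d0 dl0 hgood; elim: n j => [|n IH] j.
  by rewrite big_geq// mulr0 addr0; exact: l1_dif_iter_avg_dirac.
have [_ sc _] := convpow_prob n pnu.
have pn := pnu n.+1 isT; have [_ sn _] := pn.
rewrite /= iter_avg_conv// dif_convl//; last exact: asum_iter_avg.
have sg := asum_dif d (asum_iter_avg d j sc).
rewrite big_nat_recr//=.
case: (boolP (good n.+1)) => [gn|_]; last first.
  rewrite addn0; apply: le_trans (l1_conv sg sn) _.
  by rewrite (l1_prob pn) mulr1.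
have [s vs vsd] := hgood n.+1 isT gn.
apply: le_trans (l1_conv_two_atoms sg pn d0 dl0 vs vsd) _.
have -> : avg d (dif d (iter j (avg d) (convpow nu n))) =
  dif d (iter j.+1 (avg d) (convpow nu n)).
  by apply/funext => k; rewrite /= /avg /dif; field.
set S := (\sum_(1 <= i < n.+1) good i)%N in IH *.
set x : R := j.+1%:R + dl / 2 * S%:R.
(* Two distinct atoms of mass at least [dl] fit into total mass 1; hence the weight [1 - 2 dl] is
   nonnegative. *)
have dl12 : 2 * dl <= 1.
  have [v0 sv v1] := pn; rewrite -[leRHS]v1.
  pose e (t k : int) : R := if k == t then dl else 0.
  have se t : asum (e t) by exact: asum_single.
  have -> : 2 * dl = csum (fun k => e s k + e (s + d) k) by rewrite csumD// !csum_single; ring.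
  apply: le_csum => // [|k]; first exact: asumD.
  rewrite /e; case: eqP => [->|_].
    rewrite ifF; first by rewrite addr0.
    by apply/negbTE; rewrite -subr_eq0 opprD addrA subrr sub0r oppr_eq0.
  by case: eqP => [->|_]; rewrite ?add0r.
have x1 : 1 <= x.
  by rewrite /x -[j.+1]add1n natrD; have := mulr_ge0 dl0 (ler0n R S); have := ler0n R j; lra.
have h1 := IH j; have h2 := IH j.+1.
rewrite (_ : j.+2%:R + _ = x + 1) in h2; last by rewrite /x -[j.+2]addn1 natrD; ring.
rewrite (_ : j.+1%:R + _ = x + dl / 2); last by rewrite /x (natrD _ S) /=; ring.
have st := ler_wpM2l (ler0n R 2) (inv_sqrt_step x1 dl0).
apply: le_trans st; rewrite mulrDr; apply: lerD.
  by rewrite mulrCA ler_wpM2l ?mulr_ge0.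
by rewrite mulrCA ler_wpM2l// subr_ge0.
Qed.

End Convolution.

(** * Uniform aperiodicity *)

Section BezoutSubadditive.
Context {R : realType}.

(* Bezout coefficients stay bounded because all the numbers involved are below [n]. *)
Lemma subadditive_gcd_bound (n : nat) : exists2 K : R, 0 <= K &
  forall (P : pred nat) (N : nat -> R) (x : R), 0 <= x -> (forall d, 0 <= N d) -> N 0%N = 0 ->
    (forall d e, N (d + e)%N <= N d + N e) -> (forall d e, N d <= N (d + e)%N + N e) ->
    (forall d, (d < n)%N -> P d -> N d <= x) ->
    N (\big[gcdn/0%N]_(0 <= d < n | P d) d) <= K * x /\
    (\big[gcdn/0%N]_(0 <= d < n | P d) d <= n)%N.
Proof.
elim: n => [|n [K K0 IH]].
  by exists 0 => // P N x x0 _ N0 _ _ _; rewrite big_geq// N0 mul0r.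
exists ((n * n + n)%N%:R + n%:R * K + K) => [|P N x x0 Nge N0 NS NB Nx].
  by rewrite !addr_ge0 ?mulr_ge0 ?ler0n.
have [h1 h2] := IH P N x x0 Nge N0 NS NB (fun d dn => Nx d (ltnW dn)).
rewrite big_mkcond big_nat_recr//= -big_mkcond.
set g := \big[gcdn/0%N]_(0 <= d < n | P d) d in h1 h2 *.
have Kle : K * x <= ((n * n + n)%N%:R + n%:R * K + K) * x.
  by rewrite ler_wpM2r// lerDr addr_ge0 ?mulr_ge0 ?ler0n.
case: ifPn => [Pn|_]; last by rewrite gcdn0; split; [exact: (le_trans h1 Kle)|exact: leqW].
have [nE|n0] := posnP n.
  have -> : gcdn g n = g by rewrite [X in gcdn g X]nE gcdn0.
  by split; [exact: (le_trans h1 Kle)|exact: leqW].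
split; last by apply/leqW/dvdn_leq => //; exact: dvdn_gcdr.
have NM c d : N (c * d)%N <= c%:R * N d.
  elim: c => [|c IHc]; first by rewrite mul0n N0 mul0r.
  rewrite mulSn -addn1 natrD mulrDl mul1r addrC; apply: le_trans (NS _ _) _.
  by rewrite lerD2l.
rewrite gcdnC; have [km kn E knn] := egcdnP g n0.
have kn_le : (kn <= n)%N.
  apply: leq_trans (ltnW knn); rewrite leq_pmulr// gcdn_gt0 n0//.
have km_le : (km <= n * n + n)%N.
  have gn : (gcdn n g <= n)%N by rewrite dvdn_leq// dvdn_gcdl.
  have : (km * n <= n * n + n)%N by rewrite E leq_add// leq_mul.
  by apply: leq_trans; rewrite leq_pmulr.
(* Bezout in natural numbers, [km * n = kn * g + gcdn n g]: the value at the gcd is bounded by those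
   at [km * n] and [kn * g]. *)
have := NB (gcdn n g) (kn * g)%N; rewrite addnC -E => /le_trans; apply.
apply: le_trans (lerD (NM _ _) (NM _ _)) _.
have := Nx n (ltnSn n) Pn => Nn.
have e1 : km%:R * N n <= (n * n + n)%N%:R * x by apply: ler_pM; rewrite ?ler_nat.
have e2 : kn%:R * N g <= n%:R * (K * x) by apply: ler_pM; rewrite ?ler_nat.
have e3 : 0 <= K * x by rewrite mulr_ge0.
rewrite !mulrDl -[n%:R * K * x]mulrA; lra.
Qed.

End BezoutSubadditive.

(** * Heavy atoms outside every proper coset *)

Section UniformAperiodicity.
Context {R : realType}.
Local Notation delta0 := (@Defs.dirac0 R).

Lemma zprob_prob_mass (v : int -> R) : zprob v -> prob_mass v.
Proof.
move=> [v0]; rewrite /zmass => v1.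
have sv : asum v.
  by rewrite /asum; under eq_esum do rewrite ger0_norm//; rewrite v1 ltry.
by split => //; apply: EFin_inj; rewrite -esum_csum.
Qed.

Lemma le_asum (u : int -> R) (c : R) : (forall k, 0 <= u k) ->
  (\esum_(k in [set: int]) (u k)%:E <= c%:E)%E -> asum u /\ csum u <= c.
Proof.
move=> u0 uc; have su : asum u.
  rewrite /asum; under eq_esum do rewrite ger0_norm//.
  exact: le_lt_trans uc (ltry _).
by split => //; rewrite -lee_fin -esum_csum.
Qed.

(** A substitute for the indicator of [[-M, M]]: a multiple of [G] will dominate the light atoms in
    that window. *)
Lemma interval_majorant (M : nat) : exists G : int -> R,
  [/\ asum G, forall k, 0 <= G k & forall k : int, `|k| <= M%:Z -> 1 <= G k].
Proof.
elim: M => [|M [G [sG G0 G1]]].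
  exists delta0; split; first exact: asum_dirac0.
    by move=> k; rewrite /Defs.dirac0; case: ifP.
  by move=> k; rewrite normr_le0 => /eqP ->.
pose e (t k : int) : R := if k == t then 1 else 0.
have e0 t k : 0 <= e t k by rewrite /e; case: ifP.
exists (fun k => G k + (e M.+1%:Z k + e (- M.+1%:Z) k)); split.
- by apply: asumD => //; apply: asumD; exact: asum_single.
- by move=> k; rewrite !addr_ge0.
- move=> k kM; have [kle|kgt] := leP `|k| M%:Z.
    by rewrite (le_trans (G1 k kle))// lerDl addr_ge0.
  have [->|->] : k = M.+1%:Z \/ k = - M.+1%:Z by lia.
    have : e M.+1%:Z M.+1%:Z = 1 by rewrite /e eqxx.
    by have := G0 M.+1%:Z; have := e0 (- M.+1%:Z) M.+1%:Z; lra.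
  have : e (- M.+1%:Z) (- M.+1%:Z) = 1 by rewrite /e eqxx.
  by have := G0 (- M.+1%:Z); have := e0 (M.+1%:Z) (- M.+1%:Z); lra.
Qed.

(** Otherwise the total mass 1 would be at most [rho] (the coset), plus [a / M] (outside the window,
    by Markov), plus [dl] times the mass of [G] (light atoms in the window). With [eps = 1 - rho],
    the choice of [M] and [dl] makes each of the last two at most [eps / 4]. Both constants depend
    on [a] and [rho] only. *)
Lemma heavy_atom_off_coset (a rho : R) : 0 < a -> rho < 1 ->
  exists (M : nat) (dl : R), 0 < dl /\
  forall v : int -> R, prob_mass v -> (m1 v <= a%:E)%E ->
  forall beta r : int, (zmass v (coset beta r) <= rho%:E)%E ->
  exists k : int, [/\ `|k| <= M%:Z, dl <= v k & ~ coset beta r k].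
Proof.
move=> a0 rho1; pose eps := 1 - rho; have eps0 : 0 < eps by rewrite subr_gt0.
pose M := Num.bound (a / (eps / 4)).
have [G [sG G0 G1]] := interval_majorant M.
have cG := csum_ge0 G0.
pose dl := eps / 4 / (csum G + 1).
exists M, dl; split; first by rewrite !divr_gt0// ltr_wpDl.
move=> v [v0 sv v1] hm beta r hr; apply: contrapT => hno.
have [sm m1a] : asum (fun k : int => `|k%:~R| * v k) /\ csum (fun k : int => `|k%:~R| * v k) <= a.
  by apply: le_asum => // k; rewrite mulr_ge0.
pose w (k : int) : R := if k \in coset beta r then v k else 0.
have [sw wrho] : asum w /\ csum w <= rho.
  apply: le_asum => [k|]; first by rewrite /w; case: ifP.
  move: hr; rewrite /zmass esum_mkcond; apply: le_trans.
  by apply: le_esum => k _; rewrite /w; case: ifP.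
have aM : a / (eps / 4) < M%:R.
  have := @archi_boundP R (a / (eps / 4)); apply.
  by rewrite divr_ge0 ?ltW// divr_gt0.
have M0 : 0 < M%:R :> R by apply: le_lt_trans aM; rewrite divr_ge0 ?ltW// divr_gt0.
(* The three contributions as a pointwise majorant of [v]; where it fails there is a heavy atom off
   the coset, against [hno]. *)
have := le_csum sv (asumD sw (asumD (asumZ M%:R^-1 sm) (asumZ dl sG))).
have -> : csum (fun i => w i + (M%:R^-1 * (`|i%:~R| * v i) + dl * G i)) =
    csum w + (M%:R^-1 * csum (fun k : int => `|k%:~R| * v k) + dl * csum G).
  have [s1 s2] := (asumZ M%:R^-1 sm, asumZ dl sG).
  by rewrite (csumD sw (asumD s1 s2)) (csumD s1 s2) !csumZ.
rewrite v1 leNgt => H; suff: False by []; apply: (negP (H _)).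
  move=> k; have dG : 0 <= dl * G k by rewrite mulr_ge0// /dl !divr_ge0 ?ltW// ltr_wpDl.
  have mk : 0 <= M%:R^-1 * (`|k%:~R| * v k) by rewrite !mulr_ge0// invr_ge0 ltW.
  rewrite {1}/w; case: ifPn => [_|kC]; first by rewrite lerDl addr_ge0.
  rewrite add0r; have [kM|kM] := leP `|k| M%:Z.
    have [vd|vd] := leP dl (v k).
      by exfalso; apply: hno; exists k; split => //; rewrite notin_setE in kC.
    have := ler_wpM2l (ltW (le_lt_trans (v0 k) vd)) (G1 k kM).
    by rewrite mulr1; lra.
  have : v k <= M%:R^-1 * (`|k%:~R| * v k).
    rewrite ler_pdivlMl// ler_wpM2r// -intr_norm -[M%:R]/(M%:Z%:~R) ler_int; exact: ltW.
  by lra.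
have e1 : M%:R^-1 * csum (fun k : int => `|k%:~R| * v k) <= eps / 4.
  rewrite ler_pdivrMl//; apply: le_trans m1a _.
  by move: aM; rewrite ltr_pdivrMr ?divr_gt0// => /ltW.
have e2 : dl * csum G <= eps / 4.
  rewrite /dl mulrAC ler_pdivrMr ?ltr_wpDl// ler_wpM2l ?lerDl// ltW// divr_gt0//.
by rewrite /eps in e1 e2 eps0; lra.
Qed.

End UniformAperiodicity.

(** * Decay of the first difference like [1 / sqrt n] *)

Section UniformSmoothing.
Context {R : realType}.

Definition overlap (dl : R) (v : int -> R) (d : nat) : bool :=
  `[< exists2 s : int, dl <= v s & dl <= v (s + d%:Z) >].

(* A common divisor [g <> 1] of the differences would put all atoms heavier than [dl]
   into a single coset of [gZ]. *)
Lemma gcd_overlap (M : nat) (dl : R) (v : int -> R) :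
  (forall beta r : int, beta != 1 -> beta != -1 ->
    exists k : int, [/\ `|k| <= M%:Z, dl <= v k & ~ coset beta r k]) ->
  \big[gcdn/0%N]_(0 <= d < (2 * M).+1 | overlap dl v d) d = 1%N.
Proof.
move=> h; set g := \big[gcdn/0%N]_(_ <= d < _ | _) d; apply/eqP/negPn/negP => g1.
(* The choice [beta = 0] only serves to produce one heavy atom [k0]; the coset of [g] through [k0]
   then misses another one. *)
have [k0 [k0M v0 _]] := h 0 0 isT isT.
have [|//|k [kM vk]] := h g%:Z k0; first by rewrite eqz_nat.
apply; have gdvd d : (d < (2 * M).+1)%N -> overlap dl v d -> (g %| d)%N.
  move=> dM od; rewrite /g big_mkcond (bigD1_seq d) ?iota_uniq ?mem_index_iota//= od.
  exact: dvdn_gcdl.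
have [k0k|kk0] := leP k0 k.
  have [m mE] : exists m : nat, k = k0 + m%:Z by exists `|k - k0|%N; lia.
  have : (g %| m)%N.
    by apply: gdvd; [lia|apply/asboolP; exists k0 => //; rewrite -mE].
  by case/dvdnP => q qE; exists q%:Z; rewrite mE qE; lia.
have [m mE] : exists m : nat, k0 = k + m%:Z by exists `|k0 - k|%N; lia.
have : (g %| m)%N.
  by apply: gdvd; [lia|apply/asboolP; exists k => //; rewrite -mE].
by case/dvdnP => q qE; exists (- q%:Z); rewrite mE qE; lia.
Qed.

(** Pigeonhole: call [d] rare if it is good for fewer than [n / L] indices. If each of the [n]
    indices had a good rare [d], the at most [L] rare values would account for [n] pairs, while each
    accounts for fewer than [n / L]. *)
Lemma frequent_property (good : nat -> nat -> bool) (L n : nat) : (0 < n)%N ->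
  exists2 i, (1 <= i < n.+1)%N & forall d, (d < L)%N -> good i d ->
    (n <= (\sum_(1 <= i' < n.+1) good i' d) * L)%N.
Proof.
move=> n0; apply: contrapT => hno.
pose cnt d := (\sum_(1 <= i < n.+1) good i d)%N.
have hbad i : (1 <= i < n.+1)%N -> (1 <= \sum_(0 <= d < L | (cnt d * L < n)%N) good i d)%N.
  move=> hi; apply: contrapT => h0; apply: hno; exists i => // d dL gd.
  rewrite leqNgt; apply/negP => hd; apply: h0.
  by rewrite big_mkcond (bigD1_seq d) ?iota_uniq ?mem_index_iota//= hd gd.
have : (n <= \sum_(1 <= i < n.+1) \sum_(0 <= d < L | (cnt d * L < n)%N) good i d)%N.
  rewrite -[leqLHS](_ : (\sum_(1 <= i < n.+1) 1)%N = n); last first.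
    by rewrite sum_nat_const_nat subn1 muln1.
  by rewrite big_nat [leqRHS]big_nat; apply: leq_sum => i /hbad.
rewrite exchange_big /= => h1.
have h2 : (n * L <= \sum_(0 <= d < L | (cnt d * L < n)%N) n.-1)%N.
  apply: leq_trans (leq_mul h1 (leqnn L)) _; rewrite big_distrl /=.
  by apply: leq_sum => d; rewrite -/(cnt d) => hd; rewrite -ltnS prednK.
have h3 : (\sum_(0 <= d < L | (cnt d * L < n)%N) n.-1 <= L * n.-1)%N.
  rewrite big_mkcond; apply: (@leq_trans (\sum_(0 <= d < L) n.-1)%N).
    by apply: leq_sum => d _; case: ifP.
  by rewrite sum_nat_const_nat subn0.
have L0 : (0 < L)%N.
  by case: (L) hbad => // hb; have := hb 1%N; rewrite big_geq//= => /(_ n0).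
by move: (leq_trans h2 h3); rewrite mulnC leq_pmul2l// => /(leq_trans _); nia.
Qed.

(** The constant precedes the sequence [nu], so that the bound applies with the same [C] to all
    tails of the given sequence. The index given by the pigeonhole has heavy-atom distances of gcd
    1, each shared by a positive proportion of the factors. *)
Lemma uniform_smoothing (a rho : R) : 0 < a -> rho < 1 ->
  exists2 C : R, 0 < C & forall nu : nat -> int -> R,
  (forall i, (1 <= i)%N -> prob_mass (nu i)) ->
  (forall i, (1 <= i)%N -> (m1 (nu i) <= a%:E)%E) ->
  (forall i, (1 <= i)%N -> forall beta r : int, beta != 1 -> beta != -1 ->
      (zmass (nu i) (coset beta r) <= rho%:E)%E) ->
  forall n, (1 <= n)%N -> l1 (dif 1 (convpow nu n)) <= C / Num.sqrt n%:R.
Proof.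
move=> a0 rho1; have [M [dl [dl0 hdl]]] := heavy_atom_off_coset a0 rho1.
have [K K0 hK] := @subadditive_gcd_bound R (2 * M).+1.
(* A frequent distance occurs for at least [n / (2M+1)] factors, each worth [dl / 2] of a coin flip:
   [c n] flips in all. *)
pose c := dl / (2 * (2 * M).+1%:R).
have c0 : 0 < c by rewrite divr_gt0// mulr_gt0.
exists ((K + 1) * (2 / Num.sqrt c)) => [|nu pnu m1nu cnu n n0].
  by rewrite mulr_gt0 ?ltr_wpDl// divr_gt0// sqrtr_gt0.
have [_ sn _] := convpow_prob n pnu.
(* The norm of the [d]-difference is subadditive in [d], as the Bezout argument requires. *)
pose N (d : nat) := l1 (dif d%:Z (convpow nu n)).
have N0 : N 0%N = 0.
  rewrite /N (_ : dif _ _ = fun=> 0); last by apply/funext => k; rewrite /dif subr0 subrr.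
  rewrite /l1 normr0; under eq_fun do rewrite -[0](mul0r 0).
  by rewrite csumZ ?mul0r//; apply: asum_le sn => k; rewrite normr0.
have NS d e : N (d + e)%N <= N d + N e.
  have sd := asum_dif d%:Z sn; have se := asum_dif e%:Z sn.
  rewrite /N -[l1 (dif e _)](l1_shift d%:Z); apply: le_trans (ler_l1D _ _) => //; last exact: asum_shift.
  rewrite le_eqVlt; apply/orP; left; apply/eqP; congr l1; apply/funext => k; rewrite /dif PoszD opprD addrA; ring.
have NB d e : N d <= N (d + e)%N + N e.
  have sd := asum_dif d%:Z sn; have se := asum_dif e%:Z sn.
  have sde := asum_dif (d + e)%:Z sn.
  rewrite /N -[l1 (dif e _)](l1_shift d%:Z) -[X in _ <= _ + X]l1N; apply: le_trans (ler_l1D _ _).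
  - rewrite le_eqVlt; apply/orP; left; apply/eqP; congr l1; apply/funext => k; rewrite /dif PoszD opprD addrA; ring.
  - exact: sde.
  - by apply: asumN; exact: asum_shift.
have [i hi hfreq] := @frequent_property (fun i d => overlap dl (nu i) d) (2 * M).+1 n n0.
have i1 : (1 <= i)%N by case/andP: hi.
have gi : \big[gcdn/0%N]_(0 <= d < (2 * M).+1 | overlap dl (nu i) d) d = 1%N.
  by apply: gcd_overlap => beta r b1 b2; apply: hdl; [exact: pnu|exact: m1nu|exact: cnu].
pose x := 2 / Num.sqrt c / Num.sqrt n%:R.
have x0 : 0 <= x by rewrite !divr_ge0// sqrtr_ge0.
have [] := hK (overlap dl (nu i)) N x x0 (fun d => l1_ge0 _) N0 NS NB.
  move=> d dM od; have [->|d0] := posnP d; first by rewrite N0.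
  have := @l1_dif_avg_convpow R nu (fun i => overlap dl (nu i) d) d%:Z dl n 0 pnu.
  rewrite eqz_nat -lt0n d0 => /(_ isT (ltW dl0)) /=.
  have ov j : (1 <= j)%N -> overlap dl (nu j) d ->
      exists2 s : int, dl <= nu j s & dl <= nu j (s + d%:Z) by move=> _ /asboolP.
  move=> /(_ ov) /le_trans; apply.
  have h := hfreq d dM od; set S := (\sum_(_ <= _ < _) _)%N in h *.
  rewrite /x -[leRHS]mulrA ler_wpM2l// -invfM -sqrtrM ?(ltW c0)//.
  have cn0 : 0 < c * n%:R by rewrite mulr_gt0// ltr0n.
  have SS : n%:R <= S%:R * (2 * M).+1%:R :> R by rewrite -natrM ler_nat.
  have cS : c * n%:R <= 1 + dl / 2 * S%:R.
    apply: (@le_trans _ _ (dl / 2 * S%:R)); last by rewrite lerDr.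
    rewrite /c invfM mulrA -!mulrA ler_pM2l// ler_pM2l ?invr_gt0//.
    by rewrite mulrC ler_pdivrMr.
  rewrite lef_pV2 ?posrE ?sqrtr_gt0//; last exact: lt_le_trans cS.
  by rewrite ler_sqrt//; apply: le_trans (ltW cn0) cS.
rewrite gi => h _; apply: le_trans h _.
have -> : (K + 1) * (2 / Num.sqrt c) / Num.sqrt n%:R = (K + 1) * x.
  by rewrite /x [RHS]mulrA.
by rewrite ler_wpM2r// lerDl.
Qed.

End UniformSmoothing.

(** * Second moments and the weighted estimate *)

Section WeightedSmoothing.
Context {R : realType}.
Implicit Types (u v g : int -> R).
Local Notation delta0 := (@Defs.dirac0 R).

Definition xmul u (k : int) : R := k%:~R * u k.

Definition moment2 u : R := csum (fun k : int => k%:~R ^+ 2 * u k).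

Definition centered v := [/\ prob_mass v, asum (fun k : int => k%:~R ^+ 2 * v k) &
  csum (xmul v) = 0].

(** On integers [|k| <= k^2]. *)
Lemma asum_xmul u : asum (fun k : int => k%:~R ^+ 2 * u k) -> asum (xmul u).
Proof.
apply: asum_le => k; rewrite /xmul [leLHS]normrM [leRHS]normrM ler_wpM2r// (ger0_norm (sqr_ge0 _)).
rewrite -[leRHS]real_normK ?num_real//.
have [->|k0] := eqVneq k 0; first by rewrite normr0 expr0n.
rewrite expr2 ler_peMr// -intr_norm -[1]/(1%:~R) ler_int; lia.
Qed.

Lemma zconv_xmul g v : asum g -> asum v -> asum (xmul g) -> asum (xmul v) ->
  xmul (zconv g v) = (fun k => zconv (xmul g) v k + zconv g (xmul v) k).
Proof.
move=> sg sv sxg sxv; apply/funext => k; rewrite /xmul !zconvE -csumZ; last exact: asum_conv_row.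
rewrite -csumD; [|exact: (asum_conv_row k sxg sv)|exact: (asum_conv_row k sg sxv)].
by congr csum; apply/funext => j; rewrite rmorphB /=; ring.
Qed.

(** In the expansion of [(i + j)^2] the cross term sums to twice the product of the two means, which
    is zero. *)
Lemma centered_conv u v : centered u -> centered v ->
  centered (zconv u v) /\ moment2 (zconv u v) = moment2 u + moment2 v.
Proof.
move=> [pu s2u mu] [pv s2v mv]; have [_ su u1] := pu; have [_ sv v1] := pv.
have [sxu sxv] := (asum_xmul s2u, asum_xmul s2v).
have E : (fun p : int * int => (p.1 + p.2)%:~R ^+ 2 * (u p.1 * v p.2)) =
   (fun p => (p.1%:~R ^+ 2 * u p.1) * v p.2 +
     (2 * (xmul u p.1 * xmul v p.2) + u p.1 * (p.2%:~R ^+ 2 * v p.2))).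
  by apply/funext => -[i j]; rewrite /xmul rmorphD /=; ring.
have s1 := asum_prod s2u sv; have s2 := asumZ 2 (asum_prod sxu sxv).
have s3 := asum_prod su s2v.
have sE : asum (fun p : int * int => (p.1 + p.2)%:~R ^+ 2 * (u p.1 * v p.2)).
  by rewrite E; apply: asumD => //; exact: asumD.
have /= [h1 h2] := @csum_conv R (fun k => k%:~R ^+ 2) u v su sv sE; split; first split => //.
- exact: prob_mass_conv.
- rewrite zconv_xmul// csumD; [|exact: asum_conv..].
  by rewrite !csum_conv1// mu mv mul0r mulr0 addr0.
- rewrite /moment2 h2 E (csumD s1 (asumD s2 s3)) (csumD s2 s3).
  rewrite csumZ; last exact: asum_prod.
  rewrite (csum_prod s2u sv) (csum_prod sxu sxv) (csum_prod su s2v).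
  by rewrite mu mv u1 v1; ring.
Qed.

Lemma centered_dirac0 : centered delta0 /\ moment2 delta0 = 0.
Proof.
have E (f : int -> R) : f 0 = 0 -> (fun k => f k * delta0 k) = fun=> 0.
  by move=> f0; apply/funext => k; rewrite /Defs.dirac0; case: eqP => [->|_]; rewrite ?f0 ?mul0r ?mulr0.
have c0 : csum ((fun=> 0) : int -> R) = 0.
  by have := csum_single (0 : int) (0 : R); under eq_fun do rewrite if_same.
have s0 : asum ((fun=> 0) : int -> R).
  by apply: asum_le (@asum_dirac0 R) => k; rewrite normr0.
split; first split.
- exact: prob_mass_dirac0.
- by rewrite E// expr0n.
- by rewrite /xmul E.
- by rewrite /moment2 E// expr0n.
Qed.

Lemma centered_convpow (nu : nat -> int -> R) n : (forall i, (1 <= i)%N -> centered (nu i)) ->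
  centered (convpow nu n) /\
  moment2 (convpow nu n) = \sum_(1 <= i < n.+1) moment2 (nu i).
Proof.
move=> cnu; elim: n => [|n [IH1 IH2]] /=.
  by have [h1 h2] := centered_dirac0; rewrite big_geq.
have [h1 h2] := centered_conv IH1 (cnu n.+1 isT).
by rewrite big_nat_recr//= -IH2.
Qed.

(** Cauchy-Schwarz in the form [2 |k| <= k^2 / s + s], summed against [u]. *)
Lemma l1_xmul_le u (s : R) : centered u -> 0 < s -> moment2 u <= s ^+ 2 -> l1 (xmul u) <= s.
Proof.
move=> [[u0 su u1] s2 _] s0 hs.
have b1 := asumZ s^-1 s2; have b2 := asumZ s su.
have b3 := asumZ 2^-1 (asumD b1 b2).
apply: (@le_trans _ _ (csum (fun k : int => 2^-1 * (s^-1 * (k%:~R ^+ 2 * u k) + s * u k)))).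
  apply: le_csum => // [|k]; first exact/asum_abs/asum_xmul.
  rewrite /xmul normrM (ger0_norm (u0 k)).
  rewrite [leRHS](_ : _ = 2^-1 * (s^-1 * k%:~R ^+ 2 + s) * u k); last ring.
  rewrite ler_wpM2r// -[k%:~R ^+ 2]real_normK ?num_real//; set y := `|_|.
  rewrite -subr_ge0 (_ : _ - _ = 2^-1 * s^-1 * (y - s) ^+ 2); last first.
    by field; rewrite gt_eqF.
  by rewrite mulr_ge0 ?sqr_ge0// mulr_ge0// invr_ge0 ltW.
rewrite (csumZ _ (asumD b1 b2)) (csumD b1 b2) !csumZ// u1 -/(moment2 u).
have : s^-1 * moment2 u <= s by rewrite ler_pdivrMl// -expr2.
lra.
Qed.

(** Fubini for the triple product: bounding [u] by its norm leaves the product of [g] and [v] up to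
    a shear, which is summable. *)
Lemma zconvA u v g : asum u -> asum v -> asum g ->
  zconv (zconv u v) g = zconv u (zconv v g).
Proof.
move=> su sv sg; apply/funext => k.
pose F (p : int * int) := u (k - p.2) * (v (p.2 - p.1) * g p.1).
have sF : asum F.
  pose e (p : int * int) := (p.1, p.2 - p.1).
  have be : bijective e.
    by exists (fun p => (p.1, p.2 + p.1)) => -[i j]; rewrite /e /= ?subrK ?addrK.
  apply: asum_le (asumZ (l1 u) (asum_reindex be (asum_prod sg sv))) => -[i j].
  rewrite /F /e /= !normrM (ger0_norm (l1_ge0 u)) [`|v _| * _]mulrC.
  by rewrite ler_wpM2r ?mulr_ge0// l1_ge.
have -> : zconv (zconv u v) g k = csum (fun j => csum (fun i => F (j, i))).
  rewrite zconvE; congr csum; apply/funext => j; rewrite zconvE mulrC -csumZ; last exact: asum_conv_row.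
  rewrite -[RHS](csum_shift (- j)); congr csum; apply/funext => i.
  rewrite /F /= opprK addrK (_ : k - (i + j) = k - j - i); last ring.
  by ring.
rewrite csum_swap// zconvE; congr csum; apply/funext => i.
rewrite zconvE -csumZ; last exact: asum_conv_row.
by [].
Qed.

Lemma convpow_split (nu : nat -> int -> R) p q : (forall i, (1 <= i)%N -> prob_mass (nu i)) ->
  convpow nu (p + q) = zconv (convpow nu p) (convpow (fun i => nu (p + i)%N) q).
Proof.
move=> pnu; have pnu' i : (1 <= i)%N -> prob_mass (nu (p + i)%N).
  by move=> i1; apply: pnu; rewrite (leq_trans i1)// leq_addl.
have [_ sp _] := convpow_prob p pnu.
elim: q => [|q IH].
  rewrite addn0 /= /Defs.dirac0 zconv_single; apply/funext => k.
  by rewrite mul1r subr0.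
rewrite addnS /= IH -addnS zconvA//.
  by have [_ ] := convpow_prob q pnu'.
by have [_ ] := pnu' q.+1 isT.
Qed.

(* The Leibniz rule lets the discrete derivative fall on either factor, so that no
   logarithm is lost when weighting by [k]. *)
Lemma l1_xmul_dif_conv u v : centered u -> centered v ->
  l1 (xmul (dif 1 (zconv u v))) <=
    l1 (xmul u) * l1 (dif 1 v) + 1 + l1 (dif 1 u) * l1 (xmul v).
Proof.
move=> [pu s2u mu] [pv s2v mv]; have [_ su u1] := pu; have [_ sv v1] := pv.
have [sxu sxv] := (asum_xmul s2u, asum_xmul s2v).
have [sdu sdv] := (asum_dif 1 su, asum_dif 1 sv).
have E : xmul (dif 1 u) = (fun k => dif 1 (xmul u) k + u (k - 1)).
  by apply/funext => k; rewrite /xmul /dif rmorphB /=; ring.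
have sxdu : asum (xmul (dif 1 u)).
  by rewrite E; apply: asumD; [exact: asum_dif|exact: (asum_shift 1)].
have su1 := asum_shift 1 su; have sdxu := asum_dif 1 sxu.
rewrite dif_convl// zconv_xmul// E zconvDl// -dif_convl// dif_convr//.
rewrite zconv_shiftl.
have s1 := asum_conv sxu sdv; have s2 := asum_shift 1 (asum_conv su sv).
have s3 := asum_conv sdu sxv.
apply: le_trans (ler_l1D (asumD s1 s2) s3) _; apply: lerD; last exact: l1_conv.
apply: le_trans (ler_l1D s1 s2) _; apply: lerD; first exact: l1_conv.
by rewrite l1_shift (l1_prob (prob_mass_conv pu pv)).
Qed.

(** Both halves of the product contain at least [n / 4] factors. Each has first absolute moment of
    order [sqrt n] and first difference of order [1 / sqrt n], so the products in the Leibniz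
    estimate stay bounded. *)
Lemma weighted_smoothing (nu : nat -> int -> R) (C A : R) (n0 : nat) : 0 < C ->
  (forall i, (1 <= i)%N -> centered (nu i)) ->
  (forall p n, (1 <= n)%N -> l1 (dif 1 (convpow (fun i => nu (p + i)%N) n)) <= C / Num.sqrt n%:R) ->
  (forall n, (n0 <= n)%N -> \sum_(1 <= i < n.+1) moment2 (nu i) <= A * n%:R) ->
  exists B : R, forall n, (n0 <= n)%N -> (2 <= n)%N -> l1 (xmul (dif 1 (convpow nu n))) <= B.
Proof.
move=> C0 cnu hC hA; pose A' := Num.max A 1.
have A'0 : 0 < A' by rewrite lt_max ltr01 orbT.
(* [sqrt (A' n)] bounds the first moments, [C / sqrt r] the differences, and [sqrt n <= 2 sqrt r]
   for a half of length [r]. *)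
pose D := 2 * Num.sqrt A' * C.
exists (D + 1 + D) => n nn0 n2.
pose p := n./2; pose q := (n - p)%N.
have npq : n = (p + q)%N by rewrite subnKC// /p; lia.
have p1 : (1 <= p)%N by rewrite /p; lia.
have q1 : (1 <= q)%N by rewrite /q /p; lia.
have [np4 nq4] : (n <= 4 * p)%N /\ (n <= 4 * q)%N by rewrite /q /p; lia.
have cnu' i : (1 <= i)%N -> centered (nu (p + i)%N) by move=> i1; apply: cnu; lia.
have pnu i : (1 <= i)%N -> prob_mass (nu i) by move=> /cnu[].
have [cp mp] := centered_convpow p cnu; have [cq mq] := centered_convpow q cnu'.
set u := convpow nu p in cp mp *; set v := convpow (fun i => nu (p + i)%N) q in cq mq *.
have nu0 : 0 < n%:R :> R by rewrite ltr0n; lia.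
pose s := Num.sqrt A' * Num.sqrt n%:R.
have s0 : 0 < s by rewrite mulr_gt0 ?sqrtr_gt0.
have ss : s ^+ 2 = A' * n%:R by rewrite exprMn !sqr_sqrtr ?ler0n// ltW.
have sumle : moment2 u + moment2 v <= s ^+ 2.
  rewrite ss; apply: le_trans (_ : A * n%:R <= _); last first.
    by rewrite ler_wpM2r// le_max lexx.
  apply: le_trans (hA n nn0); rewrite mp mq le_eqVlt; apply/orP; left; apply/eqP.
  rewrite npq [RHS](@big_cat_nat _ _ _ p.+1)//=; last by lia.
  congr (_ + _); rewrite -[p.+1]addn1 addnC -[(p + q).+1]addnS [(p + q.+1)%N]addnC big_addn addnK.
  by apply: eq_bigr => i _; rewrite addnC.
have [mu0 mv0] : 0 <= moment2 u /\ 0 <= moment2 v.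
  have [[u0 _ _] _ _] := cp; have [[v0 _ _] _ _] := cq.
  by split; apply: csum_ge0 => k; rewrite mulr_ge0 ?sqr_ge0.
have xu : l1 (xmul u) <= s by apply: l1_xmul_le => //; lra.
have xv : l1 (xmul v) <= s by apply: l1_xmul_le => //; lra.
have du : l1 (dif 1 u) <= C / Num.sqrt p%:R.
  by have := hC 0%N p p1; under eq_fun do rewrite add0n.
have dv : l1 (dif 1 v) <= C / Num.sqrt q%:R := hC p q q1.
have key r : (1 <= r)%N -> (n <= 4 * r)%N -> s * (C / Num.sqrt r%:R) <= D.
  move=> r1 nr; have r0 : 0 < Num.sqrt r%:R :> R by rewrite sqrtr_gt0 ltr0n.
  have : Num.sqrt n%:R <= 2 * Num.sqrt r%:R :> R.
    rewrite -[2 * _]ger0_norm ?mulr_ge0 ?(ltW r0)// -sqrtr_sqr exprMn sqr_sqrtr ?ler0n//.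
    rewrite ler_sqrt; last by rewrite mulr_ge0 ?ler0n// exprn_ge0.
    by rewrite -[2 ^+ 2]/(2%:R ^+ 2) -natrX -natrM ler_nat (leq_trans nr).
  move=> h; rewrite /s /D mulrA ler_pdivrMr//.
  rewrite [leRHS](_ : _ = Num.sqrt A' * (2 * Num.sqrt r%:R) * C); last ring.
  by rewrite ler_wpM2r ?(ltW C0)// ler_wpM2l ?sqrtr_ge0.
rewrite npq convpow_split// -/u -/v; apply: le_trans (l1_xmul_dif_conv cp cq) _.
apply: lerD; first apply: lerD => //.
  apply: le_trans (key q q1 nq4).
  by apply: ler_pM; rewrite ?l1_ge0.
apply: le_trans (key p p1 np4).
by rewrite [leRHS]mulrC; apply: ler_pM; rewrite ?l1_ge0.
Qed.

End WeightedSmoothing.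

(** * Summation by parts *)

Section SummationByParts.
Context {R : realType}.

(** After a shift of the index the sum becomes that of [S k] times [mu (k - 1) - mu k]. There are no
    boundary terms: [S] grows at most linearly and [mu] has a finite first moment, so both pieces
    are summable. *)
Lemma summation_by_parts (mu S : int -> R) (b c : R) : centered mu ->
  0 <= b -> 0 <= c -> (forall k, `|S k| <= b * `|k%:~R| + c) ->
  asum (fun k => mu k * (S (k + 1) - S k)) /\
  `|csum (fun k => mu k * (S (k + 1) - S k))| <=
    b * l1 (xmul (dif 1 mu)) + c * l1 (dif 1 mu).
Proof.
move=> [[mu0 smu mu1] s2 _] b0 c0 hS.
have sx := asum_xmul s2.
have bnd (s : R) (T : int -> R) : (forall k, `|T k| <= b * `|k%:~R| + s) -> 0 <= s ->
    asum (fun k => T k * mu k).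
  move=> hT s0; apply: asum_le (asumD (asumZ b (asum_abs sx)) (asumZ s smu)) => k.
  rewrite /xmul [X in `|b * X + _|]normrM (ger0_norm (mu0 k)) mulrA -mulrDl.
  rewrite [leLHS]normrM [leRHS]normrM (ger0_norm (mu0 k)) ler_wpM2r//.
  by rewrite [leRHS]ger0_norm// addr_ge0// mulr_ge0.
have sS := bnd c S hS c0.
have sS1 : asum (fun k => S (k + 1) * mu k).
  apply: (bnd (b + c)); last by rewrite addr_ge0.
  move=> k; apply: le_trans (hS _) _; rewrite addrA lerD2r -{3}[b]mulr1 -mulrDr.
  by rewrite ler_wpM2l// rmorphD /=; apply: le_trans (ler_normD _ _) _; rewrite normr1.
have E : (fun k => mu k * (S (k + 1) - S k)) = (fun k => S (k + 1) * mu k - S k * mu k).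
  by apply/funext => k; ring.
have sd := asum_dif 1 smu.
have sxd : asum (xmul (dif 1 mu)).
  rewrite (_ : xmul _ = (fun k => dif 1 (xmul mu) k + mu (k - 1))).
    by apply: asumD; [exact: asum_dif|exact: (asum_shift 1)].
  by apply/funext => k; rewrite /xmul /dif rmorphB /=; ring.
rewrite E; split; first exact: asumB.
rewrite csumB// -(csum_shift 1 (fun k => S (k + 1) * mu k)) /=.
have sS1' := asum_shift 1 sS1.
rewrite -csumB//; apply: le_trans (ler_abs_csum (asumB sS1' sS)) _.
have [sa sb] := (asum_abs sxd, asum_abs sd).
rewrite /l1 -!csumZ// -csumD; [|exact: asumZ..].
apply: le_csum => [| |k].
- exact/asum_abs/asumB.
- by apply: asumD; exact: asumZ.
- rewrite subrK -mulrBr normrM /xmul [X in b * X]normrM mulrA -mulrDl.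
  by rewrite ler_wpM2r.
Qed.

(** As [mu n] has mass 1, the average is [l] plus the sum of [mu n] against the increments of [S].
    Sublinearity of [S] bounds this remainder by [e B + c C / sqrt n], with [e] arbitrary and [c]
    depending on [e]. *)
Lemma kernel_average_cvg (mu : nat -> int -> R) (u S : int -> R) (l B C : R) (n0 : nat) :
  (forall n, centered (mu n)) -> 0 <= C ->
  (forall n, (1 <= n)%N -> l1 (dif 1 (mu n)) <= C / Num.sqrt n%:R) ->
  (forall n, (n0 <= n)%N -> l1 (xmul (dif 1 (mu n))) <= B) ->
  (forall k, S (k + 1) - S k = u k - l) ->
  (forall e, 0 < e -> exists2 c, 0 <= c & forall k, `|S k| <= e * `|k%:~R| + c) ->
  (fun n => zsum (fun k => mu n k * u k)) @ \oo --> l%:E.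
Proof.
move=> cmu C0 hC hB dS hS.
pose r n := csum (fun k => mu n k * (S (k + 1) - S k)).
have E n : zsum (fun k => mu n k * u k) = (l + r n)%:E.
  (* Any slope would do here; only summability is needed. *)
  have [c c0 hc] := hS 1 ltr01.
  have [s1 _] := summation_by_parts (cmu n) ler01 c0 hc.
  have [[_ sm m1] _ _] := cmu n.
  have E1 : (fun k => mu n k * u k) = (fun k => l * mu n k + mu n k * (S (k + 1) - S k)).
    by apply/funext => k; rewrite dS; ring.
  have sE : asum (fun k => mu n k * u k) by rewrite E1; apply: asumD => //; exact: asumZ.
  rewrite /zsum (csum_def_fin sE) E1 csumD//; last exact: asumZ.
  by rewrite csumZ// m1 mulr1.
rewrite (funext E); apply: cvg_EFin; first by apply: nearW.
rewrite -[X in _ --> X]addr0; apply: cvgD; first exact: cvg_cst.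
apply/cvgrPdist_le => e e0.
pose B' := Num.max B 1; have B'0 : 0 < B' by rewrite lt_max ltr01 orbT.
have e'0 : 0 < e / (2 * B') by rewrite divr_gt0// mulr_gt0.
have [c c0 hc] := hS _ e'0.
(* From [n >= (2 c C / e)^2] on, [c C / sqrt n] is at most [e / 2]; the slope [e / (2 B')] provides
   the other half. *)
pose N := (maxn n0 (Num.bound ((2 * c * C / e) ^+ 2)).+1)%N.
exists N => // n /= Nn; rewrite sub0r normrN.
have [_ h] := summation_by_parts (cmu n) (ltW e'0) c0 hc.
apply: le_trans h _.
have nn0 : (n0 <= n)%N by apply: leq_trans Nn; rewrite leq_maxl.
have nb : ((Num.bound ((2 * c * C / e) ^+ 2)).+1 <= n)%N by apply: leq_trans Nn; rewrite leq_maxr.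
have n1 : (1 <= n)%N by apply: leq_trans nb.
have sn0 : 0 < Num.sqrt n%:R :> R by rewrite sqrtr_gt0 ltr0n.
have h1 : e / (2 * B') * l1 (xmul (dif 1 (mu n))) <= e / 2.
  apply: (@le_trans _ _ (e / (2 * B') * B')).
    by rewrite ler_pM2l// (le_trans (hB n nn0))// le_max lexx.
  by rewrite le_eqVlt; apply/orP; left; apply/eqP; field; rewrite gt_eqF.
have h2 : c * l1 (dif 1 (mu n)) <= e / 2.
  apply: (@le_trans _ _ (c * (C / Num.sqrt n%:R))).
    by rewrite ler_wpM2l// hC.
  rewrite mulrA ler_pdivrMr// -ler_pdivrMl ?divr_gt0//.
  rewrite (_ : (e / 2)^-1 * (c * C) = 2 * c * C / e); last by field; rewrite gt_eqF.
  have q0 : 0 <= 2 * c * C / e by rewrite divr_ge0 ?mulr_ge0// ltW.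
  rewrite -[leLHS]ger0_norm// -sqrtr_sqr ler_sqrt ?ler0n//.
  have := archi_boundP (sqr_ge0 (2 * c * C / e)) => /ltW /le_trans; apply.
  by rewrite ler_nat ltnW.
by rewrite [leRHS](_ : _ = e / 2 + e / 2); [exact: lerD|field].
Qed.

End SummationByParts.

(** * Maximal ergodic theorem *)

Section Birkhoff.
Context {R : realType} {d : measure_display} {X : measurableType d}.
Variable m : probability X R.
Implicit Types (T : X -> X) (f g : X -> R) (E : set X).

Definition bsum T f (n : nat) (x : X) : R := \sum_(i < n) f (iter i T x).

Definition mpt T := measurable_fun [set: X] T /\
  forall A, measurable A -> m (T @^-1` A) = m A.

Lemma bsumS T f n x : bsum T f n.+1 x = f x + bsum T f n (T x).
Proof.
rewrite /bsum big_ord_recl /=; congr (_ + _); apply: eq_bigr => i _.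
by rewrite -iterSr.
Qed.

Lemma measurable_bsum T f n : measurable_fun [set: X] T -> measurable_fun [set: X] f ->
  measurable_fun [set: X] (bsum T f n).
Proof.
move=> mT mf; elim: n => [|n IH].
  rewrite (_ : bsum _ _ _ = cst 0); first exact: measurable_cst.
  by apply/funext => x; rewrite /bsum big_ord0.
rewrite (_ : bsum _ _ _ = f \+ (bsum T f n \o T)); last by apply/funext => x; exact: bsumS.
by apply: measurable_funD => //; exact: measurableT_comp.
Qed.

(* [bmax T f N] is the maximum of [bsum T f n] over [n <= N]. *)
Fixpoint bmax T f (n : nat) (x : X) : R :=
  if n is n'.+1 then Num.max 0 (f x + bmax T f n' (T x)) else 0.

Lemma bmax_ge0 T f n x : 0 <= bmax T f n x.
Proof. by case: n => //= n; rewrite le_max lexx. Qed.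

Lemma bmaxS T f n x : bmax T f n x <= bmax T f n.+1 x.
Proof.
elim: n x => [|n IH] x; first exact: bmax_ge0.
rewrite [leLHS]/= [leRHS]/= ge_max !le_max lexx /=; apply/orP; right.
by rewrite lerD2l; exact: IH.
Qed.

Lemma bsum_le_bmax T f n N x : (n <= N)%N -> bsum T f n x <= bmax T f N x.
Proof.
elim: N n x => [|N IH] [|n] x // nN; try by rewrite /bsum big_ord0 bmax_ge0.
by rewrite bsumS /= le_max lerD2l IH ?orbT.
Qed.

Lemma measurable_bmax T f n : measurable_fun [set: X] T -> measurable_fun [set: X] f ->
  measurable_fun [set: X] (bmax T f n).
Proof.
move=> mT mf; elim: n => [|n IH]; first exact: measurable_cst.
apply: (@measurable_maxr _ _ _ _ (cst 0) (f \+ (bmax T f n \o T))) => //.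
by apply: measurable_funD => //; exact: measurableT_comp.
Qed.

Lemma integral_invariant T E (g : X -> \bar R) : mpt T -> measurable E -> T @^-1` E = E ->
  measurable_fun [set: X] g -> (forall x, (0 <= g x)%E) ->
  (\int[m]_(x in E) g (T x) = \int[m]_(x in E) g x)%E.
Proof.
move=> [mT pT] mE TE mg g0.
rewrite -[in LHS]TE -(@ge0_integral_pushforward _ _ _ _ _ T mT m E g)//.
  by apply: eq_measure_integral => A mA _; exact: pT.
exact: measurable_funTS.
Qed.

Lemma integrable_mpt T f : mpt T -> m.-integrable [set: X] (EFin \o f) ->
  m.-integrable [set: X] (EFin \o (f \o T)).
Proof.
move=> mpT /integrableP[mf fi]; have [mT pT] := mpT; apply/integrableP; split.
  exact: (measurableT_comp mf mT).
have -> : (\int[m]_x `|(EFin \o (f \o T)) x| = \int[m]_x `|(EFin \o f) x|)%E.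
  apply: (@integral_invariant T setT (fun x => `|(f x)%:E|%E)) => //.
  exact: measurableT_comp.
exact: fi.
Qed.

Lemma integrable_bmax T f n : mpt T -> m.-integrable [set: X] (EFin \o f) ->
  m.-integrable [set: X] (EFin \o bmax T f n).
Proof.
move=> mpT fi; elim: n => [|n IH]; first exact: integrable0.
have mf : measurable_fun [set: X] f by case/integrableP: fi => /measurable_EFinP.
have h := integrableD measurableT (integrable_abse fi) (integrable_mpt mpT IH).
apply: le_integrable h => //.
  by apply/measurable_EFinP; apply: measurable_bmax => //; case: mpT.
move=> x _; rewrite lee_fin ger0_norm ?bmax_ge0// [leRHS]ger0_norm.
  rewrite /= ge_max addr_ge0 ?bmax_ge0//= lerD2r; exact: ler_norm.
by rewrite addr_ge0 ?bmax_ge0.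
Qed.

(* Garsia: [f >= bmax T f N - bmax T f N \o T] where [bmax T f N.+1 > 0]. *)
Lemma maximal_ergodic T f E : mpt T -> measurable E -> T @^-1` E = E ->
  m.-integrable [set: X] (EFin \o f) -> (forall x, E x -> exists n, 0 < bsum T f n x) ->
  0 <= \int[m]_(x in E) f x.
Proof.
move=> mpT mE TE fi hE; have [mT pT] := mpT.
have mf : measurable_fun [set: X] f by case/integrableP: fi => /measurable_EFinP.
pose phi n x : R := if 0 < bmax T f n.+1 x then f x else 0.
have mphi n : measurable_fun [set: X] (phi n).
  apply: measurable_fun_ifT => //; apply: measurable_fun_ltr => //.
  exact: measurable_bmax.
have phi_le n x : `|phi n x| <= `|f x| by rewrite /phi; case: ifP => // _; rewrite normr0.
have iphi n : m.-integrable [set: X] (EFin \o phi n).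
  apply: le_integrable fi => //; first exact/measurable_EFinP.
  by move=> x _; rewrite lee_fin.
have iE (g : X -> R) : m.-integrable [set: X] (EFin \o g) -> m.-integrable E (EFin \o g).
  exact: integrableS.
have phi0 n : 0 <= \int[m]_(x in E) phi n x.
  have ib := integrable_bmax n mpT fi; have ibT := integrable_mpt mpT ib.
  have h : \int[m]_(x in E) bmax T f n x <= \int[m]_(x in E) (phi n x + (bmax T f n \o T) x).
    apply: le_Rintegral => //; first exact: iE.
      by have := integrableD mE (iE _ (iphi n)) (iE _ ibT).
    move=> x _; apply: le_trans (bmaxS T f n x) _; rewrite /phi /=.
    case: ltP => [|h]; rewrite ?add0r.
      by rewrite lt_max ltxx /= => h; rewrite max_r// ltW.
    exact: le_trans h (bmax_ge0 _ _ _ _).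
  (* By invariance of [E] the two integrals of [bmax] cancel and leave that of [phi n]. *)
  have e : \int[m]_(x in E) (bmax T f n \o T) x = \int[m]_(x in E) bmax T f n x.
    congr fine; apply: (@integral_invariant T E (EFin \o bmax T f n)) => //.
      by apply/measurable_EFinP; exact: measurable_bmax.
    by move=> x; rewrite lee_fin bmax_ge0.
  move: h; rewrite RintegralD//; [|exact: iE..].
  by rewrite e lerDr.
have cvg_phi x : E x -> (EFin \o phi^~ x) n @[n --> \oo] --> (f x)%:E.
  move=> /hE [n hn]; apply: cvg_near_cst; exists n => // N /= nN.
  by rewrite /phi ifT//; apply: lt_le_trans hn (bsum_le_bmax _ _ _ _); exact: leqW.
(* On [E] some sum is positive, so [phi n] is eventually equal to [f]; [|f|] dominates. *)
have [_ _ hc] := @dominated_convergence _ _ _ m E mE (fun n => EFin \o phi n) (EFin \o f)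
   (fun x => `|(f x)%:E|%E)
   (fun n => measurable_funTS (proj2 (measurable_EFinP _ _) (mphi n)))
   (measurable_funTS (proj2 (measurable_EFinP _ _) mf))
   (aeW _ cvg_phi) (iE (fun x => `|f x|) (integrable_abse fi))
   (aeW _ (fun x n _ => phi_le n x)).
apply: fine_ge0; rewrite -(cvg_lim _ hc)//; apply: lime_ge; first by apply/cvg_ex; eexists; exact: hc.
apply: nearW => n /=; rewrite -[X in (_ <= X)%E]fineK; first by rewrite lee_fin; exact: phi0.
exact: integrable_fin_num (iE _ (iphi n)).
Qed.

(** Takes the place of the set where the upper limit of the averages exceeds a level: with
    [g = f - q] it is strictly invariant, and it supplies the positive sum that the maximal theorem
    asks for. *)
Definition unbdd T g : set X :=
  \bigcap_(k : nat) \bigcup_(n : nat) [set x | k%:R < bsum T g n x].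

Lemma measurable_unbdd T g : measurable_fun [set: X] T -> measurable_fun [set: X] g ->
  measurable (unbdd T g).
Proof.
move=> mT mg; apply: bigcap_measurable => // k _; apply: bigcup_measurable => n _.
have := @measurable_fun_ltr _ _ _ _ (cst k%:R) (bsum T g n) (measurable_cst _) (measurable_bsum n mT mg).
move=> /(_ measurableT [set true]) h; have := h I; rewrite setTI.
by congr (measurable _); apply/seteqP; split.
Qed.

(** Sums started at [x] and at [T x] differ by the single term [g x]. *)
Lemma unbdd_invariant T g : T @^-1` (unbdd T g) = unbdd T g.
Proof.
apply/seteqP; split => x h k _ /=.
  have [n _ /= hn] := h (Num.bound (k%:R + `|g x|)) I.
  exists n.+1 => //=; rewrite bsumS.
  have := archi_boundP (addr_ge0 (ler0n R k) (normr_ge0 (g x))).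
  have := ler_norm (- g x); rewrite normrN; lra.
have [n _ /= hn] := h (Num.bound (k%:R + `|g x|)) I.
have := archi_boundP (addr_ge0 (ler0n R k) (normr_ge0 (g x))).
case: n hn => [|n]; first by rewrite /bsum big_ord0 ltNge ler0n.
by rewrite bsumS => h1 h2; exists n => //=; have := ler_norm (g x); lra.
Qed.

Lemma unbdd_gt0 T g x : unbdd T g x -> exists n, 0 < bsum T g n x.
Proof. by move=> /(_ 0%N I) [n _ h]; exists n. Qed.

Lemma not_unbdd T g x : ~ unbdd T g x -> exists c : R, forall n, bsum T g n x <= c.
Proof.
move=> h; apply: contrapT => hno; apply: h => k _.
apply: contrapT => hk; apply: hno; exists k%:R => n; rewrite leNgt; apply/negP => hn.
by apply: hk; exists n.
Qed.

(** The maximal theorem for [T] and [g] and for [S] and [h] gives two nonnegative integrals over the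
    intersection, whose total is [- c] times its measure. To be used with [g = f - q], [h = p - f]
    and [c = q - p], for [T] and [S] among [tau] and its inverse. *)
Lemma null_unbddI T S g h (c : R) : mpt T -> mpt S ->
  S @^-1` (unbdd T g) = unbdd T g -> T @^-1` (unbdd S h) = unbdd S h ->
  m.-integrable [set: X] (EFin \o g) -> m.-integrable [set: X] (EFin \o h) ->
  0 < c -> (forall x, g x + h x = - c) ->
  m (unbdd T g `&` unbdd S h) = 0%E.
Proof.
move=> mpT mpS ST TS ig ih c0 gh; set E := _ `&` _.
have [[mT _] [mS _]] := (mpT, mpS).
have [mg mh] : measurable_fun [set: X] g /\ measurable_fun [set: X] h.
  by split; [case/integrableP: ig|case/integrableP: ih] => /measurable_EFinP.
have mE : measurable E by apply: measurableI; exact: measurable_unbdd.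
have TE : T @^-1` E = E by rewrite preimage_setI unbdd_invariant TS.
have SE : S @^-1` E = E by rewrite preimage_setI unbdd_invariant ST.
have h1 := maximal_ergodic mpT mE TE ig (fun x Ex => unbdd_gt0 Ex.1).
have h2 := maximal_ergodic mpS mE SE ih (fun x Ex => unbdd_gt0 Ex.2).
have iE (g' : X -> R) : m.-integrable [set: X] (EFin \o g') -> m.-integrable E (EFin \o g').
  exact: integrableS.
have : \int[m]_(x in E) (g x + h x) = - c * fine (m E).
  by under eq_Rintegral do rewrite gh; rewrite Rintegral_cst.
rewrite RintegralD//; [|exact: iE..] => e.
have fE : m E \is a fin_num by exact: fin_num_measure.
have m0 : 0 <= fine (m E) by apply: fine_ge0.
have : c * fine (m E) <= 0 by lra.
rewrite pmulr_rle0// => m1; rewrite -(fineK fE); congr EFin; lra.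
Qed.

(** The maximal theorem for [f - k] gives [k m(E) <= \int_E f] for every [k]. Hence almost every
    point has a finite upper rate. *)
Lemma null_unbdd_bigcap T f : mpt T -> m.-integrable [set: X] (EFin \o f) ->
  m (\bigcap_(k : nat) unbdd T (fun x => f x - k%:R)) = 0%E.
Proof.
move=> mpT fi; set E := \bigcap_(_ in _) _; have [mT _] := mpT.
have mf : measurable_fun [set: X] f by case/integrableP: fi => /measurable_EFinP.
have ic (r : R) : m.-integrable [set: X] (EFin \o cst r).
  exact: finite_measure_integrable_cst.
have mE : measurable E.
  apply: bigcap_measurable => // k _; apply: measurable_unbdd => //.
  by apply: measurable_funB => //; exact: measurable_cst.
have TE : T @^-1` E = E.
  by rewrite preimage_bigcap; apply: eq_bigcapr => k _; exact: unbdd_invariant.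
have iE (g' : X -> R) : m.-integrable [set: X] (EFin \o g') -> m.-integrable E (EFin \o g').
  exact: integrableS.
have fE : m E \is a fin_num by exact: fin_num_measure.
have m0 : 0 <= fine (m E) by apply: fine_ge0.
have key (k : nat) : k%:R * fine (m E) <= \int[m]_(x in E) f x.
  have ifk : m.-integrable [set: X] (EFin \o (fun x => f x - k%:R)).
    by have := integrableB measurableT fi (ic k%:R).
  have := maximal_ergodic mpT mE TE ifk (fun x Ex => unbdd_gt0 (Ex k I)).
  rewrite (RintegralB mE (iE _ fi) (iE _ (ic k%:R))) Rintegral_cst//; lra.
move: m0; rewrite le_eqVlt => /predU1P[h|h]; first by rewrite -(fineK fE) -h.
have I0 : 0 <= \int[m]_(x in E) f x by have := key 0%N; rewrite mul0r.
have := key (Num.bound (\int[m]_(x in E) f x / fine (m E))).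
by rewrite -ler_pdivlMr// leNgt archi_boundP// divr_ge0// ltW.
Qed.

End Birkhoff.

(** * Two-sided pointwise ergodic theorem *)

Section Rates.
Context {R : realType}.
Implicit Types (s t : nat -> R).

(** Implied by [limsup s n / n < b] and implying [limsup s n / n <= b]; unlike these it is the exact
    complement of unboundedness of the sums of [f - b]. *)
Definition upper_rate s (b : R) := exists c : R, forall n, s n <= b * n%:R + c.

Definition lower_rate s (a : R) := exists c : R, forall n, a * n%:R - c <= s n.

Lemma upper_rate_mono s b b' : b <= b' -> upper_rate s b -> upper_rate s b'.
Proof.
by move=> bb [c h]; exists c => n; apply: le_trans (h n) _; rewrite lerD2r ler_wpM2r.
Qed.

Lemma lower_rate_mono s a a' : a' <= a -> lower_rate s a -> lower_rate s a'.
Proof.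
by move=> aa [c h]; exists c => n; apply: le_trans (h n); rewrite lerD2r ler_wpM2r.
Qed.

Lemma lower_le_upper_rate s a b : lower_rate s a -> upper_rate s b -> a <= b.
Proof.
move=> [c hc] [c' hc']; rewrite leNgt; apply/negP => ba.
have ab0 : 0 < a - b by rewrite subr_gt0.
have := archi_boundP (divr_ge0 (normr_ge0 (c + c')) (ltW ab0)).
set n := Num.bound _; rewrite ltr_pdivrMr//.
have := hc n; have := hc' n; have := ler_norm (c + c').
rewrite mulrBr ![n%:R * _]mulrC; lra.
Qed.

(** Take for [l] the infimum of the upper rates of [s]. A rational [q < l] is no upper rate of [s],
    so every [p < q] is a lower rate of both sequences; a rational [p > l] is no lower rate of [s],
    so every [q > p] is an upper rate of [t]. *)
Lemma common_rate s t :
  (exists b, upper_rate s b) -> (exists a, lower_rate s a) ->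
  (forall p q : rat, p < q -> [/\ upper_rate s (ratr q) \/ lower_rate s (ratr p),
     upper_rate s (ratr q) \/ lower_rate t (ratr p) &
     upper_rate t (ratr q) \/ lower_rate s (ratr p)]) ->
  exists l : R, forall e, 0 < e -> exists2 c, 0 <= c & forall n,
    `|s n - l * n%:R| <= e * n%:R + c /\ `|t n - l * n%:R| <= e * n%:R + c.
Proof.
move=> [b0 hb0] [a0 ha0] hpq.
pose U := [set b | upper_rate s b].
have U0 : has_inf U.
  by split; [exists b0|exists a0 => b hb; exact: lower_le_upper_rate ha0 hb].
pose l := inf U.
have l_lb b : upper_rate s b -> l <= b by move=> hb; apply: ge_inf => //; case: U0.
have l_up e : 0 < e -> exists2 b, upper_rate s b & b < l + e.
  by move=> e0; have [b hb bl] := inf_adherent e0 U0; exists b.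
have rats (x y : R) : x < y -> exists p q : rat, [/\ x < ratr p, ratr p < ratr q :> R, ratr q < y & p < q].
  move=> xy; have [p /[!in_itv]/= /andP[xp py]] := rat_in_itvoo xy.
  have [q /[!in_itv]/= /andP[pq qy]] := rat_in_itvoo py.
  by exists p, q; split => //; rewrite -(ltr_rat R).
have us e : 0 < e -> upper_rate s (l + e).
  by move=> /l_up[b hb bl]; exact: upper_rate_mono (ltW bl) hb.
have low e : 0 < e -> lower_rate s (l - e) /\ lower_rate t (l - e).
  move=> e0; have [|p [q [lp pq ql /hpq[h1 h2 _]]]] := rats (l - e) l.
    by rewrite ltrBlDr ltrDl.
  have nq : ~ upper_rate s (ratr q) by move=> /l_lb; rewrite leNgt ql.
  by case: h1 => // h1; case: h2 => // h2; split; apply: lower_rate_mono (ltW lp) _.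
have ut e : 0 < e -> upper_rate t (l + e).
  move=> e0; have [|p [q [lp pq ql /hpq[_ _ h3]]]] := rats l (l + e).
    by rewrite ltrDl.
  case: h3 => [h|h]; first exact: upper_rate_mono (ltW ql) h.
  have [|b hb bl] := l_up (ratr p - l); first by rewrite subr_gt0.
  by have := lower_le_upper_rate h hb; rewrite leNgt; move: bl; rewrite addrC subrK => ->.
exists l => e e0.
have [[c1 h1] [c2 h2]] := (us e e0, ut e e0).
have [[c3 h3] [c4 h4]] := low e e0.
exists (`|c1| + `|c2| + `|c3| + `|c4|); first by rewrite !addr_ge0.
move=> n; have := h1 n; have := h2 n; have := h3 n; have := h4 n.
have := ler_norm c1; have := ler_norm c2; have := ler_norm c3; have := ler_norm c4.
have := normr_ge0 c1; have := normr_ge0 c2; have := normr_ge0 c3; have := normr_ge0 c4.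
rewrite !ler_norml !mulrDl !mulNr.
by move=> *; split; lra.
Qed.

End Rates.

(** * Rates along the two half-orbits, almost everywhere *)

Section Ergodic.
Context {R : realType} {d : measure_display} {X : measurableType d}.
Variable m : probability X R.

Lemma bsumB_cst (T : X -> X) (f : X -> R) (b : R) n x :
  bsum T (fun y => f y - b) n x = bsum T f n x - b * n%:R.
Proof.
by rewrite /bsum big_split /= sumr_const card_ord mulNrn mulr_natr.
Qed.

Lemma bsumN (T : X -> X) (f : X -> R) n x :
  bsum T (fun y => - f y) n x = - bsum T f n x.
Proof. by rewrite /bsum sumrN. Qed.

Lemma upper_rate_not_unbdd T (f : X -> R) b x : ~ unbdd T (fun y => f y - b) x ->
  upper_rate (fun n => bsum T f n x) b.
Proof.
by move=> /not_unbdd[c h]; exists c => n; have := h n; rewrite bsumB_cst; lra.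
Qed.

Lemma lower_rate_not_unbdd T (f : X -> R) a x : ~ unbdd T (fun y => a - f y) x ->
  lower_rate (fun n => bsum T f n x) a.
Proof.
move=> /not_unbdd[c h]; exists c => n; have := h n.
rewrite (_ : (fun y => a - f y) = (fun y => - (f y - a))); last by apply/funext => y; rewrite opprB.
by rewrite bsumN bsumB_cst; lra.
Qed.

Lemma two_sided_ergodic (tau tauinv : X -> X) (f : X -> R) : inv_mpt m tau tauinv ->
  m.-integrable [set: X] (EFin \o f) ->
  {ae m, forall x, exists l : R, forall e, 0 < e -> exists2 c, 0 <= c & forall n,
    `|bsum tau f n x - l * n%:R| <= e * n%:R + c /\
    `|bsum tauinv f n x - l * n%:R| <= e * n%:R + c}.
Proof.
move=> [mt mti tK tiK pt] fi.
have mp : mpt m tau by [].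
have mpi : mpt m tauinv.
  split=> // A mA; have mA' : measurable (tauinv @^-1` A).
    by have := mti measurableT A mA; rewrite setTI.
  by rewrite -(pt _ mA'); congr (m _); apply/seteqP; split => x /=; rewrite tK.
have ic (r : R) : m.-integrable [set: X] (EFin \o cst r).
  exact: finite_measure_integrable_cst.
have fiB b : m.-integrable [set: X] (EFin \o (fun x => f x - b)).
  by have := integrableB measurableT fi (ic b).
have fBi a : m.-integrable [set: X] (EFin \o (fun x => a - f x)).
  by have := integrableB measurableT (ic a) fi.
have inv1 (g : X -> R) : tauinv @^-1` (unbdd tau g) = unbdd tau g.
  apply/funext => x; have := congr1 (fun A : set X => A (tauinv x)) (unbdd_invariant tau g).
  by rewrite /preimage /= tiK => ->.
have inv2 (g : X -> R) : tau @^-1` (unbdd tauinv g) = unbdd tauinv g.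
  apply/funext => x; have := congr1 (fun A : set X => A (tau x)) (unbdd_invariant tauinv g).
  by rewrite /preimage /= tK => ->.
have mfB b : measurable_fun [set: X] (fun x => f x - b).
  by case/integrableP: (fiB b) => /measurable_EFinP.
have mBf b : measurable_fun [set: X] (fun x => b - f x).
  by case/integrableP: (fBi b) => /measurable_EFinP.
(* Used for the pairs ([tau], [tau]), ([tau], [tauinv]) and ([tauinv], [tau]), which give the three
   alternatives of [common_rate]. Pairs of rationals are enumerated, so only countably many null
   sets are discarded. *)
have ae_pair T S : mpt m T -> mpt m S ->
   (forall g : X -> R, S @^-1` (unbdd T g) = unbdd T g) -> (forall g : X -> R, T @^-1` (unbdd S g) = unbdd S g) ->
   {ae m, forall x, forall p q : rat, p < q ->
     upper_rate (fun n => bsum T f n x) (ratr q) \/ lower_rate (fun n => bsum S f n x) (ratr p)}.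
  move=> mT mS ST TS.
  have : {ae m, forall x, forall n : nat, forall p q : rat, unpickle n = Some (p, q) -> p < q ->
     upper_rate (fun n => bsum T f n x) (ratr q) \/ lower_rate (fun n => bsum S f n x) (ratr p)}.
    apply: ae_foralln => n.
    case: (unpickle n) => [[p q]|]; last by apply: aeW.
    case: (ltP p q) => pq; last by apply: aeW => x p' q' [<- <-]; rewrite ltNge pq.
    exists (unbdd T (fun y => f y - ratr q) `&` unbdd S (fun y => ratr p - f y)); split.
    - by apply: measurableI; apply: measurable_unbdd => //; [case: mT|case: mS].
    - apply: (@null_unbddI _ _ _ m T S _ _ (ratr q - ratr p) mT mS (ST _) (TS _) (fiB _) (fBi _)).
        by rewrite subr_gt0 ltr_rat.
      by move=> x; ring.
    - move=> x /= hx; split; apply: contrapT => hu; apply: hx => p' q' [<- <-] _.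
        by left; exact: upper_rate_not_unbdd.
      by right; exact: lower_rate_not_unbdd.
  apply: filterS => x h p q pq; apply: (h (pickle (p, q))) => //; exact: pickleK.
have ae_up (g : X -> R) : m.-integrable [set: X] (EFin \o g) ->
    {ae m, forall x, exists b, upper_rate (fun n => bsum tau g n x) b}.
  move=> gi; exists (\bigcap_(k : nat) unbdd tau (fun x => g x - k%:R)); split.
  - apply: bigcap_measurable => // k _; apply: measurable_unbdd => //.
    apply: measurable_funB; last exact: measurable_cst.
    by case/integrableP: gi => /measurable_EFinP.
  - exact: null_unbdd_bigcap.
  - move=> x /= hx k _; apply: contrapT => hu; apply: hx; exists k%:R.
    exact: upper_rate_not_unbdd.
have h1 := ae_up f fi.
have h2 : {ae m, forall x, exists a, lower_rate (fun n => bsum tau f n x) a}.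
  have Nfi : m.-integrable [set: X] (EFin \o (fun x => - f x)) by have := integrableN fi.
  apply: filterS (ae_up _ Nfi) => x [b [c h]]; exists (- b), c => n.
  by have := h n; rewrite bsumN; lra.
have h3 := ae_pair tau tau mp mp (unbdd_invariant tau) (unbdd_invariant tau).
have h4 := ae_pair tau tauinv mp mpi inv1 inv2.
have h5 := ae_pair tauinv tau mpi mp inv2 inv1.
apply: filterS (filterI h1 (filterI h2 (filterI h3 (filterI h4 h5)))) => x [g1 [g2 [g3 [g4 g5]]]].
by apply: common_rate => // p q pq; split; [exact: g3|exact: g4|exact: g5].
Qed.

(* An antiderivative of k |-> f (tau^k x) - l vanishing at 0. *)
Definition cocycle (tau tauinv : X -> X) (f : X -> R) (l : R) (x : X) (k : int) : R :=
  match k with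
  | Posz n => bsum tau (fun y => f y - l) n x
  | Negz n => - \sum_(i < n.+1) (f (iter i.+1 tauinv x) - l)
  end.

Lemma cocycleS (tau tauinv : X -> X) (f : X -> R) (l : R) (x : X) (k : int) :
  cocycle tau tauinv f l x (k + 1) - cocycle tau tauinv f l x k = f (ziter tau tauinv k x) - l.
Proof.
case: k => [n|[|n]].
- by rewrite -PoszD addn1 /= /bsum big_ord_recr /= addrAC subrr add0r.
- by rewrite (_ : Negz 0 + 1 = 0)// /= /bsum big_ord0 big_ord_recr big_ord0 /=; ring.
- rewrite (_ : Negz n.+1 + 1 = Negz n); last by lia.
  by rewrite /= [in X in _ - X]big_ord_recr /=; ring.
Qed.

Lemma cocycle_bound (tau tauinv : X -> X) (f : X -> R) (l : R) (x : X) (e c : R) :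
  0 <= e -> 0 <= c ->
  (forall n, `|bsum tau f n x - l * n%:R| <= e * n%:R + c /\
    `|bsum tauinv f n x - l * n%:R| <= e * n%:R + c) ->
  forall k, `|cocycle tau tauinv f l x k| <= e * `|k%:~R| + (e + c + `|f x - l|).
Proof.
move=> e0 c0 h [n|n].
  rewrite /= bsumB_cst; apply: le_trans (proj1 (h n)) _.
  by rewrite ger0_norm ?ler0n//; have := normr_ge0 (f x - l); lra.
(* The backward part of the cocycle omits the term at [x], which [bsum tauinv] includes: hence one
   more term in the sum, and the extra [e] and [|f x - l|] in the bound. *)
have := proj2 (h n.+2); rewrite -bsumB_cst /bsum big_ord_recl /= => h'.
have -> : `|(Negz n)%:~R : R| = n.+1%:R by rewrite NegzE mulrNz normrN ger0_norm ?ler0n.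
rewrite normrN; set S := \sum_(i < n.+1) _ in h' *.
have -> : S = (f x - l + S) - (f x - l) by ring.
apply: le_trans (ler_normB _ _) _.
by apply: le_trans (lerD h' (lexx _)) _; rewrite -[n.+2]addn1 natrD; lra.
Qed.

End Ergodic.

(** * Assembly of the kernel estimates and the ergodic theorem *)

Theorem theorem3p4 (R : realType) (d : measure_display) (X : measurableType d)
  (m : probability X R) (tau tauinv : X -> X)
  (nu : nat -> int -> R) (a rho : R) :
  nonatomic m -> separable_measure m -> inv_mpt m tau tauinv ->
  0 < a -> 0 <= rho -> rho < 1 ->
  (forall n, (1 <= n)%N -> zprob (nu n)) ->
  (forall n, (1 <= n)%N -> zmean (nu n) = 0%E) ->
  (forall n, (1 <= n)%N -> (m1 (nu n) <= a%:E)%E) ->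
  (forall n, (1 <= n)%N -> forall beta r : int, beta != 1 -> beta != -1 ->
      (zmass (nu n) (coset beta r) <= rho%:E)%E) ->
  (exists (C : R) (N : nat), forall n, (N <= n)%N ->
      (\sum_(1 <= i < n.+1) m2 (nu i) <= (C * n%:R)%:E)%E) ->
  forall f : X -> R, m.-integrable setT (EFin \o f) ->
  {ae m, forall x, exists l : R,
      (fun n => zsum (fun k => convpow nu n k * f (ziter tau tauinv k x))) @ \oo --> l%:E}.
Proof.
move=> _ _ tauP a0 _ rho1 pnu mean0 m1a hcos [A [N hA]] f fi.
have pm i : (1 <= i)%N -> prob_mass (nu i) by move=> /pnu; exact: zprob_prob_mass.
have m2_ge0 i : (1 <= i)%N -> (0 <= m2 (nu i))%E.
  move=> /pnu[v0 _]; apply: esum_ge0 => k _.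
  by rewrite lee_fin mulr_ge0 ?sqr_ge0.
have s2 i : (1 <= i)%N -> asum (fun k : int => k%:~R ^+ 2 * nu i k).
  move=> i1; have [v0 _ _] := pm i i1.
  (* The growth bound holds only from [N] on; at [maxn N i] it covers the index [i], so each [nu i]
     has a finite second moment. *)
  have := hA (maxn N i) (leq_maxl _ _) => h.
  have : (m2 (nu i) <= (A * (maxn N i)%:R)%:E)%E.
    have ir : (1 <= i < (maxn N i).+1)%N by rewrite i1 ltnS leq_maxr.
    apply: le_trans h; rewrite big_nat big_mkcond (bigD1_seq i) ?iota_uniq ?mem_index_iota//= ir.
    by rewrite leeDl//; apply: sume_ge0 => j _; case: ifP => // /andP[j1 _]; exact: m2_ge0.
  by move=> /le_asum[] // k; rewrite mulr_ge0 ?sqr_ge0.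
have m2E i : (1 <= i)%N -> m2 (nu i) = (moment2 (nu i))%:E.
  move=> i1; have [v0 _ _] := pm i i1.
  by rewrite /m2 /zmass esum_csum//; [move=> k; rewrite mulr_ge0 ?sqr_ge0|exact: s2].
have cnu i : (1 <= i)%N -> centered (nu i).
  move=> i1; split; [exact: pm|exact: s2|].
  have := mean0 i i1; rewrite /zmean /zsum csum_def_fin; last exact/asum_xmul/s2.
  by move=> [].
have [C C0 hC] := uniform_smoothing a0 rho1.
have hCp p n : (1 <= n)%N ->
    l1 (dif 1 (convpow (fun i => nu (p + i)%N) n)) <= C / Num.sqrt n%:R.
  have p1 i : (1 <= i)%N -> (1 <= p + i)%N by move=> i1; rewrite (leq_trans i1)// leq_addl.
  by move=> n1; apply: hC => // i /p1; [exact: pm|exact: m1a|exact: hcos].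
have [|B hB] := weighted_smoothing (A := A) (n0 := N) C0 cnu hCp.
  move=> n /hA; rewrite big_nat (eq_bigr (fun i => (moment2 (nu i))%:E)).
    by rewrite sumEFin lee_fin -big_nat.
  by move=> i /andP[i1 _]; exact: m2E.
apply: filterS (two_sided_ergodic tauP fi) => x [l hl]; exists l.
(* The cocycle is the sublinear antiderivative; the weighted estimate is available from [maxn N 2]
   on, where both halves of the product are nonempty. *)
apply: (@kernel_average_cvg _ _ _ (cocycle tau tauinv f l x) l B C (maxn N 2)).
- by move=> n; have [] := centered_convpow n cnu.
- exact: ltW.
- by move=> n n1; have := hCp 0%N n n1; under eq_fun do rewrite add0n.
- by move=> n; rewrite geq_max => /andP[]; exact: hB.
- by move=> k; exact: cocycleS.
- move=> e e0; have [c c0 hc] := hl e e0.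
  exists (e + c + `|f x - l|); first by rewrite !addr_ge0// ltW.
  exact: cocycle_bound (ltW e0) c0 hc.
Qed.
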